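(* Let $I\subset(0,+\infty)$ be an interval and let $\Phi_\rho:E\to\mathbb{R}$, $\rho\in I$, be a family of $C^2$ functionals of the form $$\Phi_\rho(u)=A(u)-\rho B(u),\qquad \rho\in I,$$ where $B(u)\ge 0$ for every $u\in E$, and $$\text{either } A(u)\to+\infty \text{ or } B(u)\to+\infty \quad\text{as } u\in E \text{ and } \|u\|\to+\infty.$$ Suppose moreover that, for some $\alpha\in(0,1]$, $\Phi_\rho'$ and $\Phi_\rho''$ are $\alpha$-Hölder continuous on bounded sets for every $\rho\in I$. Let $\mathcal{F}$ be a homotopic family of $S_\mu$ of dimension at most $d$ with boundary $B$ (a subset of $S_\mu$, independent of $\rho$, not to be confused with the functional $B$) such that $$c_\rho:=\inf_{A\in\mathcal{F}}\max_{u\in A}\Phi_\rho(u)>\max_B\Phi_\rho,\qquad\forall\rho\in I.$$ Then, for almost every $\rho\in I$, there exist sequences $\{u_n\}\subset S_\mu$ and $\zeta_n\to0^+$ such that, as $n\to+\infty$: (i) $\Phi_\rho(u_n)\to c_\rho$; (ii) $\|\Phi_\rho'|_{S_\mu}(u_n)\|_*\to0$; (iii) $\{u_n\}$ is bounded in $E$; (iv) $\tilde m_{\zeta_n}(u_n)\le d$, where $\tilde m_{\zeta_n}$ is the approximate Morse index associated with $\Phi_\rho$.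
   Context: Setting. $(E,\langle\cdot,\cdot\rangle)$ and $(H,(\cdot,\cdot))$ are infinite-dimensional real Hilbert spaces with continuous injections $E\hookrightarrow H\hookrightarrow E'$; the injection $E\hookrightarrow H$ has norm at most $1$ and $E$ is identified with its image in $H$. Write $\|u\|^2=\langle u,u\rangle$ and $|u|^2=(u,u)$ for $u\in E$. For a fixed $\mu\in(0,+\infty)$, $S_\mu=\{u\in E: |u|^2=\mu\}$, a codimension-one submanifold of $E$ with tangent space $T_uS_\mu=\{v\in E:(u,v)=0\}$ at $u\in S_\mu$; $S_\mu$ carries the topology induced from $E$. $\|\cdot\|_*$ and $\|\cdot\|_{**}$ denote the operator norms of $\mathcal{L}(E,\mathbb{R})$ and $\mathcal{L}(E,\mathcal{L}(E,\mathbb{R}))$. For $u\in S_\mu$, $\phi'|_{S_\mu}(u)$ denotes the differential at $u$ of the restriction of $\phi$ to $S_\mu$, a linear form on $T_uS_\mu$, and $\|\phi'|_{S_\mu}(u)\|_*$ is its dual norm with respect to the norm $\|\cdot\|$ on $T_uS_\mu$ inherited from $E$. For a $C^2$ functional $\phi$ on $E$ and $\alpha\in(0,1]$, $\phi'$ and $\phi''$ are $\alpha$-Hölder continuous on bounded sets if for any $R>0$ there is $M=M(R)>0$ such that for all $u_1,u_2\in B(0,R)$ (ball of $E$): $\|\phi'(u_1)-\phi'(u_2)\|_*\le M\|u_1-u_2\|^\alpha$ and $\|\phi''(u_1)-\phi''(u_2)\|_{**}\le M\|u_1-u_2\|^\alpha$. For a $C^2$ functional $\phi$ on $E$ and $u\in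 E\setminus\{0\}$, $D^2\phi(u)$ is the continuous bilinear form $D^2\phi(u)=\phi''(u)-\frac{\phi'(u)\cdot u}{|u|^2}(\cdot,\cdot)$. For $u\in S_\mu$ and $\theta>0$ the approximate Morse index (associated with $\phi$) is $$\tilde m_\theta(u)=\sup\{\dim L : L \text{ is a subspace of } T_uS_\mu \text{ such that } D^2\phi(u)[\varphi,\varphi]<-\theta\|\varphi\|^2 \ \forall\varphi\in L\setminus\{0\}\}.$$ A family $\mathcal{F}$ of subsets of $S_\mu$ is homotopic of dimension at most $d$ with boundary $B$ if there exist a compact subset $D$ of $\mathbb{R}^d$, containing a closed subset $D_0$, and a continuous function $\eta_0$ from $D_0$ onto $B$ such that $\mathcal{F}=\{A\subset S_\mu : A=f(D)\text{ for some } f\in C(D;S_\mu)\text{ with } f=\eta_0\text{ on }D_0\}$. *)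

(* Defs.v *)
From HB Require Import structures.
From mathcomp Require Import all_boot all_order all_algebra.
From mathcomp Require Import sesquilinear.
From mathcomp Require Import all_classical all_reals all_analysis.

Set Implicit Arguments.
Unset Strict Implicit.
Unset Printing Implicit Defensive.

Import Order.TTheory GRing.Theory Num.Theory.
Import numFieldNormedType.Exports.

Local Open Scope classical_set_scope.
Local Open Scope ring_scope.

(* With [T] a subspace of [V], this is the dual (operator) norm of the
   restriction to [T] of a continuous linear map [f]. *)
Definition opnorm_on {R : realType} {V W : normedModType R}
    (T : set V) (f : V -> W) : R :=
  sup [set `|f v| | v in [set v | T v /\ `|v| <= 1]].

(* The normed space L(V, W) of continuous linear maps with the operator norm. *)
Section continuous_linear_maps.
Context (R : realType) (V W : normedModType R).

Definition clinear : {pred V -> W} :=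
  fun f => `[< linear f /\ continuous f >].

Lemma clinear_submod : submod_closed clinear.
Proof.
split.
  apply/asboolP; split=> [a x y|]; first by rewrite /= scaler0 addr0.
  exact: cst_continuous.
move=> a f g /asboolP[lf cf] /asboolP[lg cg]; apply/asboolP; split.
  move=> b x y; rewrite !fctE /= lf lg !scalerDr !scalerA [a * b]mulrC -!addrA.
  by congr (_ + _); rewrite addrCA.
by move=> x; apply: cvgD; [apply: cvgZl_tmp; exact: cf|exact: cg].
Qed.

HB.instance Definition _ :=
  GRing.isSubmodClosed.Build R (V -> W) clinear clinear_submod.

Record clin := CLin { clin_fun :> V -> W; clin_funP : clin_fun \in clinear }.

HB.instance Definition _ := [isSub for clin_fun].
HB.instance Definition _ := [Choice of clin by <:].
HB.instance Definition _ := [SubChoice_isSubLmodule of clin by <:].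

Lemma clin_linear (f : clin) : linear f.
Proof. by case: f => f /= /asboolP[]. Qed.

HB.instance Definition _ (f : clin) :=
  GRing.isLinear.Build R V W _ f (clin_linear f).

Lemma clin_continuous (f : clin) : continuous f.
Proof. by case: f => f /= /asboolP[]. Qed.

Definition opnorm (f : clin) : R := opnorm_on setT f.

Lemma opnorm_has_sup (f : clin) :
  has_sup [set `|f v| | v in [set v | setT v /\ `|v| <= 1]].
Proof.
split; first by exists `|f 0|, 0 => //=; rewrite normr0.
have /linear_bounded_continuous/bounded_funP/(_ 1)[M fM] := @clin_continuous f.
by exists M => _ [v [_ v1] <-]; exact: fM.
Qed.

Lemma opnorm_ge (f : clin) v : `|v| <= 1 -> `|f v| <= opnorm f.
Proof. by move=> v1; apply: (sup_upper_bound (opnorm_has_sup f)); exists v. Qed.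

Lemma opnorm_le (f : clin) M :
  (forall v, `|v| <= 1 -> `|f v| <= M) -> opnorm f <= M.
Proof.
move=> fM; apply: ge_sup; first by case: (opnorm_has_sup f).
by move=> _ [v [_ v1] <-]; exact: fM.
Qed.

Lemma opnormP (f : clin) v : `|f v| <= opnorm f * `|v|.
Proof.
have [->|v0] := eqVneq v 0; first by rewrite raddf0 !normr0 mulr0.
have nv0 : 0 < `|v| by rewrite normr_gt0.
have : `|f (`|v|^-1 *: v)| <= opnorm f.
  by apply: opnorm_ge; rewrite normrZ ger0_norm ?invr_ge0// mulVf ?gt_eqF.
by rewrite linearZ/= normrZ ger0_norm ?invr_ge0// ler_pdivrMl// mulrC.
Qed.

Lemma ler_opnormD (f g : clin) : opnorm (f + g) <= opnorm f + opnorm g.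
Proof.
by apply: opnorm_le => v v1; rewrite (le_trans (ler_normD _ _))// lerD// opnorm_ge.
Qed.

Lemma opnormZ (a : R) (f : clin) : opnorm (a *: f) = `|a| * opnorm f.
Proof.
have le b (g : clin) : opnorm (b *: g) <= `|b| * opnorm g.
  by apply: opnorm_le => v v1; rewrite [X in `|X|]/= normrZ ler_wpM2l// opnorm_ge.
apply/le_anti; rewrite le /=; have [->|a0] := eqVneq a 0.
  by rewrite normr0 mul0r (le_trans (normr_ge0 ((0 *: f : clin) 0))) ?opnorm_ge// normr0.
rewrite -ler_pdivlMl ?normr_gt0// -normfV.
by have := le a^-1 (a *: f); rewrite scalerA mulVf// scale1r.
Qed.

Lemma opnorm0_eq0 (f : clin) : opnorm f = 0 -> f = 0.
Proof.
move=> f0; apply: val_inj; apply/funext => v /=; apply/normr0_eq0/le_anti.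
by rewrite normr_ge0 andbT -(mul0r `|v|) -f0 opnormP.
Qed.

HB.instance Definition _ :=
  Lmodule_isNormed.Build R clin ler_opnormD opnormZ opnorm0_eq0.

Lemma clin_normE (f : clin) : `|f| = opnorm f.
Proof. by []. Qed.

End continuous_linear_maps.

Notation "''L' ( V , W )" := (clin V W)
  (at level 8, format "''L' ( V ,  W )") : type_scope.

Section C2.
Context {R : realType} {V : normedModType R}.

(* The Frechet derivative as a map into L(V, W); the default value 0 is never
   taken where [f] is differentiable. *)
Definition frechet {W : normedModType R} (f : V -> W) (u : V) : 'L(V, W) :=
  insubd 0 ('d f u : V -> W).

Lemma frechetE {W : normedModType R} (f : V -> W) (u : V) :
  differentiable f u -> frechet f u = 'd f u :> (V -> W).
Proof.
move=> df; rewrite /frechet; apply: insubdK; apply/asboolP; split.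
  by move=> a x y; rewrite linearP.
exact: diff_continuous.
Qed.

Definition C1 {W : normedModType R} (f : V -> W) :=
  (forall u, differentiable f u) /\ continuous (frechet f).

Definition C2 (phi : V -> R) := C1 phi /\ C1 (frechet phi).

(* The norms below are those of L(V, R) and L(V, L(V, R)). *)
Definition holder_on_bounded_sets (alpha : R) (phi : V -> R) :=
  forall r : R, 0 < r -> exists2 M : R, 0 < M &
    forall u1 u2, ball 0 r u1 -> ball 0 r u2 ->
      `|frechet phi u1 - frechet phi u2| <= M * `|u1 - u2| `^ alpha /\
      `|frechet (frechet phi) u1 - frechet (frechet phi) u2|
         <= M * `|u1 - u2| `^ alpha.

Definition coercive (f : V -> R) :=
  forall M : R, exists r : R, forall u, r <= `|u| -> M <= f u.

End C2.

Section dimension.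
Context {R : realType} {V : lmodType R}.

Definition lin_indep n (v : 'I_n -> V) :=
  forall a : 'I_n -> R, \sum_i a i *: v i = 0 -> forall i, a i = 0.

Definition subspace_of (L T : set V) := L `<=` T /\ submod_closed [in L].

(* The dimension of a linear subspace, as an extended real. *)
Definition edim (L : set V) : \bar R :=
  ereal_sup [set n%:R%:E | n in
    [set n | exists v : 'I_n -> V, lin_indep v /\ forall i, L (v i)]].

End dimension.

Definition inf_dim {R : realType} (V : lmodType R) := edim [set: V] = +oo%E.

(* [ip] is an inner product whose associated norm is the norm of [V]. *)
Definition hilbert {R : realType} {V : completeNormedModType R}
    (ip : {dot V for (@idfun R)}) :=
  forall u, ip u u = `|u| ^+ 2.

(* The spaces [E] and [H] are distinct types and [iota : E -> H] is the
   embedding; (u, v) and |u| for u, v in E are read through [iota]. *)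
Section sphere.
Context {R : realType} {E H : completeNormedModType R}.
Context (iota : {linear E -> H}) (ipH : {dot H for (@idfun R)}).

(* The embedding of H into E' is h |-> (h, .), the transpose of [iota]. *)
Definition gelfand_triple :=
  [/\ injective iota, forall u, `|iota u| <= `|u| &
      injective (fun (h : H) (u : E) => ipH h (iota u))].

Definition sphere (mu : R) : set E := [set u | ipH (iota u) (iota u) = mu].

Definition tangent (u : E) : set E := [set v | ipH (iota u) (iota v) = 0].

Definition D2 (phi : E -> R) (u v w : E) : R :=
  frechet (frechet phi) u v w
  - frechet phi u u / ipH (iota u) (iota u) * ipH (iota v) (iota w).

Definition dual_norm_on_sphere (phi : E -> R) (u : E) : R :=
  opnorm_on (tangent u) (frechet phi u).

Definition approx_morse_index (phi : E -> R) (theta : R) (u : E) : \bar R :=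
  ereal_sup [set edim L | L in
    [set L | subspace_of L (tangent u) /\
      forall v, L v -> v != 0 -> D2 phi u v v < - theta * `|v| ^+ 2]].

End sphere.

Section minimax.
Context {R : realType} {E : normedModType R}.

Definition homotopic_family (S : set E) (d : nat) (bd : set E)
    (F : set (set E)) :=
  exists (D D0 : set 'rV[R]_d) (eta0 : 'rV[R]_d -> E),
    [/\ compact D, D0 `<=` D, closed D0,
        {within D0, continuous eta0} /\ eta0 @` D0 = bd &
        F = [set A | exists f : 'rV[R]_d -> E,
               [/\ {within D, continuous f}, f @` D `<=` S,
                   (forall x, D0 x -> f x = eta0 x) & A = f @` D]]].

(* Taken in the extended reals, so that the maximum over an empty boundary is
   -oo; over a nonempty compact set it is the usual maximum. *)
Definition emax (phi : E -> R) (A : set E) : \bar R :=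
  ereal_sup [set (phi u)%:E | u in A].

Definition minimax (F : set (set E)) (phi : E -> R) : \bar R :=
  ereal_inf [set emax phi A | A in F].

End minimax.

(* Main.v *)
Require Import Defs.
From HB Require Import structures.
From mathcomp Require Import all_boot all_order all_algebra.
From mathcomp Require Import sesquilinear.
From mathcomp Require Import all_classical all_reals all_analysis.
From mathcomp Require Import ring lra.

Set Implicit Arguments.
Unset Strict Implicit.
Unset Printing Implicit Defensive.

Import Order.TTheory GRing.Theory Num.Theory.
Import numFieldNormedType.Exports.

Local Open Scope classical_set_scope.
Local Open Scope ring_scope.


(** The idea.  Let [c rho] be the minimax level of [Phi rho].  Since [B >= 0], it
is nonincreasing in [rho], so that for almost every [rho] there are parameters
[r] increasing to [rho] along which the slopes of [c] stay bounded
([monotone_ae_bounded_left_slope]).  At such a [rho], a member of the family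
which is nearly optimal for [Phi r] is nearly optimal for [Phi rho] as well, and
on its part where [Phi rho] is close to [c rho] the difference
[Phi r - Phi rho = (rho - r) * B] is of order [rho - r]; hence [B], and then
[A], is bounded there, and coercivity confines that part to a fixed ball
([monotonicity_trick]).

It remains to find, for one functional [phi] with minimax level [c], a point [u]
in this ball with [phi u] close to [c], small constrained gradient and
approximate Morse index at most [d] ([minimax_critical_point]).  Otherwise every
point near level [c] on a nearly optimal map [f : D -> S_mu], with [D] compact in
R^d, has either a direction of definite slope or [d + 1] orthonormal tangent
directions in whose span the constrained Hessian is definitely negative.  Then
[f] can be pushed below level [c], a contradiction ([deform_below]).

Pushing along a unit vector [e] of the negative span for a time [s] changes [phi]
by at most [s * l(e) - kappa * s^2], where [l] is the constrained gradient.  So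
the only obstruction is to choose [e] continuously in [x] while keeping [l(e)]
at most an arbitrarily small positive number.  Each single vector [e_i], with a
sign chosen from the value of [l] at one point, is suitable on a tiny cube, but
neighbouring cubes may call for opposite signs, and the push has to be cut off
at the walls of the cubes.  This is where [d + 1] directions against [d]
dimensions matter: the direction [e_i] is attached to the [i]-th of [d + 1]
shifted grids of R^d, whose walls have no common point since each of the [d]
coordinates of a point can be close to a wall of at most one grid
([separated_cubes]).  At every point some grid is then fully active and the
combined direction has norm at least one by orthonormality.

The negative span itself depends on the point, so the same device is used a
second time at a coarser scale: the domain is covered by [d + 1] families of
separated cubes on each of which the span is fixed, and the families are treated
one after the other.  The number [d + 1] of pushes depends on [d] only, so
the pushing time, and with it the gain, can be fixed before [f] is chosen. *)

(** * Inner products and Gram-Schmidt *)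

Section inner_product.
Context (R : realType) (V : completeNormedModType R) (ip : {dot V for (@idfun R)}).
Hypothesis hilb : hilbert ip.

Lemma ipC u v : ip u v = ip v u.
Proof. by rewrite (hermC ip) expr0 mul1r. Qed.

Lemma ipDl u v w : ip (u + v) w = ip u w + ip v w.
Proof. exact: linearDl. Qed.

Lemma ipZl a u w : ip (a *: u) w = a * ip u w.
Proof. exact: linearZl_LR. Qed.

Lemma ipDr u v w : ip w (u + v) = ip w u + ip w v.
Proof. by rewrite ipC ipDl !(ipC w). Qed.

Lemma ipZr a u w : ip w (a *: u) = a * ip w u.
Proof. by rewrite ipC ipZl ipC. Qed.

Lemma ip_cauchy u v : `|ip u v| <= `|u| * `|v|.
Proof.
have [->|v0] := eqVneq v 0.
  have := ipZl 0 0 u; rewrite scale0r mul0r => e.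
  by rewrite ipC e !normr0 mulr0.
have nv : 0 < `|v| by rewrite normr_gt0.
have := sqr_ge0 `| `|v| ^+ 2 *: u - ip u v *: v|.
rewrite -(hilb (_ - _)) -scaleNr ipDl !ipDr !ipZl !ipZr !hilb (ipC v u) => h.
have {}h : 0 <= `|v| ^+ 2 * (`|u| ^+ 2 * `|v| ^+ 2 - (ip u v) ^+ 2) by lra.
move: h; rewrite pmulr_rge0 ?exprn_gt0// subr_ge0 -exprMn => h.
by rewrite -[leRHS]ger0_norm ?mulr_ge0// -ler_sqr ?nnegrE// -[leLHS]normrX -[leRHS]normrX ger0_norm ?sqr_ge0 // ger0_norm ?sqr_ge0.
Qed.

End inner_product.

(** * Geometry of the sphere *)

Section sphere_geometry.
Context (R : realType) (E : completeNormedModType R) (b : E -> E -> R).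

(** What is used of the inner product of the larger space, read on the smaller
one through the embedding. *)
Definition contractive_form :=
  [/\ forall a u v w, b (a *: u + v) w = a * b u w + b v w,
      forall u v, b u v = b v u,
      forall u, 0 <= b u u &
      forall u v, `|b u v| <= `|u| * `|v|].

Hypothesis bform : contractive_form.

Let bC u v : b u v = b v u. Proof. by case: bform. Qed.
Lemma form_ge0 u : 0 <= b u u. Proof. by case: bform. Qed.
Lemma form_le u v : `|b u v| <= `|u| * `|v|. Proof. by case: bform. Qed.

Lemma formPl a u v w : b (a *: u + v) w = a * b u w + b v w.
Proof. by case: bform. Qed.

Lemma form0l w : b 0 w = 0.
Proof. by have := formPl 1 0 0 w; rewrite scale1r addr0; lra. Qed.

Lemma formDl u v w : b (u + v) w = b u w + b v w.
Proof. by rewrite -{1}[u]scale1r formPl mul1r. Qed.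

Lemma formZl a u w : b (a *: u) w = a * b u w.
Proof. by rewrite -[X in b X]addr0 formPl form0l addr0. Qed.

Lemma formDr u v w : b w (u + v) = b w u + b w v.
Proof. by rewrite bC formDl !(bC w). Qed.

Lemma formZr a u w : b w (a *: u) = a * b w u.
Proof. by rewrite bC formZl bC. Qed.

Lemma formBl u v w : b (u - v) w = b u w - b v w.
Proof. by rewrite formDl -scaleN1r formZl mulN1r. Qed.

Lemma formBr u v w : b w (u - v) = b w u - b w v.
Proof. by rewrite formDr -scaleN1r formZr mulN1r. Qed.

Lemma form_sqr_le u : b u u <= `|u| ^+ 2.
Proof. by rewrite (le_trans (ler_norm _))// expr2 form_le. Qed.

Lemma form_cvg (T : Type) (G : set_system T) (FG : Filter G) (f g : T -> E)
    (x y : E) :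
  f @ G --> x -> g @ G --> y -> (fun t => b (f t) (g t)) @ G --> b x y.
Proof.
move=> fx gy; apply/cvgrPdist_le => e e0.
have fg : (fun t => `|x - f t| * `|g t| + `|x| * `|y - g t|) @ G --> (0 : R).
  rewrite -[X in _ --> X](_ : `|x - x| * `|y| + `|x| * `|y - y| = 0); last first.
    by rewrite !subrr !normr0 mul0r mulr0 addr0.
  apply: cvgD; apply: cvgM => //; try exact: cvg_cst.
  - by apply: cvg_norm; apply: cvgB => //; exact: cvg_cst.
  - exact: cvg_norm.
  - by apply: cvg_norm; apply: cvgB => //; exact: cvg_cst.
move/cvgrPdist_le : fg => /(_ _ e0); apply: filterS => t.
rewrite sub0r normrN => h; apply: le_trans h; apply: le_trans (ler_norm _).
have -> : b x y - b (f t) (g t) = b (x - f t) (g t) + b x (y - g t).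
  by rewrite formBl formBr; ring.
by rewrite (le_trans (ler_normD _ _))// lerD// form_le.
Qed.

Variable mu : R.
Hypothesis mu_gt0 : 0 < mu.

Definition tproj (u e : E) : E := e - (b u e / mu) *: u.

(** For [v] tangent at [u] this is stereographic projection: the identity
[(1 - q)^2 * mu + 4 * q * mu = (1 + q)^2 * mu] puts [slide u v] back on the
sphere.  Being rational, it expands in [v] without any square root. *)
Definition slide (u v : E) : E :=
  let q := b v v / (4 * mu) in (1 + q)^-1 *: ((1 - q) *: u + v).

Lemma tproj_tangent u e : b u u = mu -> b u (tproj u e) = 0.
Proof. by move=> uu; rewrite formBr formZr uu divfK ?gt_eqF// subrr. Qed.

Lemma tprojD u e1 e2 : tproj u (e1 + e2) = tproj u e1 + tproj u e2.
Proof. by rewrite /tproj formDr mulrDl scalerDl opprD addrACA. Qed.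

Lemma tprojZ u a e : tproj u (a *: e) = a *: tproj u e.
Proof. by rewrite /tproj formZr scalerBr scalerA mulrA. Qed.

Lemma tproj_sum u (T : finType) (c : T -> R) (e : T -> E) :
  tproj u (\sum_i c i *: e i) = \sum_i c i *: tproj u (e i).
Proof.
rewrite (big_morph (tproj u) (@tprojD u) (_ : _ = 0)).
  by apply: eq_bigr => i _; rewrite tprojZ.
by rewrite -[X in tproj u X](scale0r 0) tprojZ scale0r.
Qed.

Let q_ge0 v : 0 <= b v v / (4 * mu).
Proof. by rewrite divr_ge0 ?form_ge0// mulr_ge0// ltW. Qed.

Lemma slide_sphere u v : b u u = mu -> b u v = 0 ->
  b (slide u v) (slide u v) = mu.
Proof.
move=> uu uv; rewrite /slide; set q := _ / _.
have q1 : 1 + q != 0 by rewrite gt_eqF// ltr_pwDl// q_ge0.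
rewrite formZl formZr !(formDl, formDr, formZl, formZr) uu (bC v) uv.
have -> : b v v = q * (4 * mu) by rewrite divfK// gt_eqF// mulr_gt0.
by field.
Qed.

Lemma slideBE u v (q := b v v / (4 * mu)) :
  slide u v - u = (1 + q)^-1 *: (v - (2 * q) *: u).
Proof.
have q1 : 1 + q != 0 by rewrite gt_eqF// ltr_pwDl// q_ge0.
apply: (scalerI q1); rewrite /slide -/q scalerBr !scalerA !mulfV// !scale1r.
rewrite addrAC -scalerBl [LHS]addrC; congr (v + _).
by rewrite -[RHS]scaleNr; congr (_ *: u); ring.
Qed.

Lemma slide0 u : slide u 0 = u.
Proof. by rewrite /slide form0l mul0r subr0 addr0 invr1 !scale1r addr0. Qed.

Lemma slide_dist K u v : `|u| <= K -> `|v| * K <= 2 * mu ->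
  `|slide u v - u| <= 2 * `|v|.
Proof.
move=> uK vK; rewrite slideBE; set q := _ / _.
have q0 : 0 <= q by exact: q_ge0.
have q1 : 0 < 1 + q by rewrite ltr_pwDl.
rewrite normrZ (ger0_norm (_ : 0 <= (1 + q)^-1)); last by rewrite invr_ge0 ltW.
have h : `|v - (2 * q) *: u| <= 2 * `|v|.
  have q20 : 0 <= 2 * q by exact: mulr_ge0.
  rewrite (le_trans (ler_normB _ _))// normrZ (ger0_norm q20).
  suff : 2 * q * `|u| <= `|v| by lra.
  apply: (@le_trans _ _ ((`|v| / (2 * mu)) * (`|v| * `|u|))).
    have -> : 2 * q * `|u| = b v v * (`|u| / (2 * mu)) by rewrite /q; field; rewrite gt_eqF.
    rewrite [leRHS](_ : _ = `|v| ^+ 2 * (`|u| / (2 * mu))); last by ring.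
    by rewrite ler_wpM2r ?form_sqr_le// divr_ge0// mulr_ge0// ltW.
  rewrite [leLHS](_ : _ = (`|v| * `|u|) / (2 * mu) * `|v|); last by ring.
  rewrite ler_piMl// ler_pdivrMr ?mulr_gt0// mul1r.
  by apply: le_trans vK; rewrite ler_wpM2l.
rewrite ler_pdivrMl//; apply: (le_trans h).
by rewrite ler_peMl ?mulr_ge0// lerDl.
Qed.

(** As [e] is tangent at [u0], only [b (u - u0) e] contributes. *)
Lemma tproj_dist u0 u e K : `|u| <= K -> b u0 e = 0 ->
  `|tproj u e - e| <= `|u - u0| * (K / mu) * `|e|.
Proof.
move=> uK u0e; rewrite /tproj addrC addrA addNr add0r normrN normrZ.
have -> : b u e = b (u - u0) e by rewrite formBl u0e subr0.
rewrite normrM normfV (gtr0_norm mu_gt0).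
have -> : `|u - u0| * (K / mu) * `|e| = (`|u - u0| * `|e|) / mu * K by ring.
apply: ler_pM => //; first by rewrite divr_ge0// ltW.
by rewrite ler_wpM2r ?form_le// invr_ge0 ltW.
Qed.

Lemma tproj_le u e K : `|u| <= K -> `|tproj u e| <= (1 + K ^+ 2 / mu) * `|e|.
Proof.
move=> uK; rewrite (le_trans (ler_normB _ _))// mulrDl mul1r lerD2l normrZ.
rewrite normrM normfV (gtr0_norm mu_gt0).
have -> : K ^+ 2 / mu * `|e| = (K * `|e|) / mu * K by ring.
apply: ler_pM => //; first by rewrite divr_ge0// ltW.
rewrite ler_wpM2r ?invr_ge0 ?(ltW mu_gt0)// (le_trans (form_le _ _))//.
by rewrite ler_wpM2r.
Qed.

Lemma slide_cvg (T : Type) (G : set_system T) (FG : Filter G) (f g : T -> E)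
    (x y : E) :
  f @ G --> x -> g @ G --> y ->
  (fun t => slide (f t) (tproj (f t) (g t))) @ G --> slide x (tproj x y).
Proof.
move=> fx gy.
have tg : (fun t => tproj (f t) (g t)) @ G --> tproj x y.
  apply: cvgB => //; apply: cvgZ => //; apply: cvgM; last exact: cvg_cst.
  exact: form_cvg.
have qg : (fun t => b (tproj (f t) (g t)) (tproj (f t) (g t)) / (4 * mu)) @ G
     --> b (tproj x y) (tproj x y) / (4 * mu).
  by apply: cvgM; [exact: form_cvg|exact: cvg_cst].
apply: cvgZ.
  apply: cvgV; first by rewrite gt_eqF// ltr_pwDl// q_ge0.
  by apply: cvgD => //; exact: cvg_cst.
apply: cvgD => //; apply: cvgZ => //; apply: cvgB => //; exact: cvg_cst.
Qed.

End sphere_geometry.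

Section gram_schmidt.
Context (R : realType) (V : completeNormedModType R) (ip : {dot V for (@idfun R)}).
Hypothesis hilb : hilbert ip.

Lemma ip_suml (T : finType) (c : T -> R) (e : T -> V) w :
  ip (\sum_i c i *: e i) w = \sum_i c i * ip (e i) w.
Proof.
rewrite (big_morph (ip^~ w) (fun x y => ipDl ip x y w) (_ : _ = 0)).
  by apply: eq_bigr => i _; rewrite ipZl.
by rewrite -(scale0r 0) ipZl mul0r.
Qed.

Lemma submod_closed_sum (L : set V) (T : finType) (c : T -> R) (e : T -> V) :
  submod_closed [in L] -> (forall i, L (e i)) -> L (\sum_i c i *: e i).
Proof.
move=> [L0 LP] Le; apply: set_mem; elim/big_ind : _ => [//|x y xL yL|i _].
  by rewrite -[x]scale1r; exact: LP.
by rewrite -[_ *: _]addr0; apply: LP => //; apply/mem_set.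
Qed.

(** Otherwise the [n] vectors [v j] would be the rows of an [n] by [k] matrix
[M] applied to [e], and a nonzero row vector killed by [M], which exists because
[k < n], would be a linear relation between them. *)
Lemma lin_indep_notin_span n k (v : 'I_n -> V) (e : 'I_k -> V)
    (M : 'I_n -> 'I_k -> R) :
  lin_indep v -> (k < n)%N -> exists j, v j != \sum_i M j i *: e i.
Proof.
move=> vfree kn; apply/not_existsP => vspan.
pose A : 'M[R]_(n, k) := \matrix_(i, j) M i j.
have /rowV0Pn[a /sub_kermxP aA a0] : kermx A != 0.
  by rewrite kermx_eq0 -row_leq_rank -ltnNge (leq_ltn_trans (rank_leq_col _)).
have : \sum_j a 0 j *: v j = 0.
  under eq_bigr => j _.
    move: (vspan j) => /negP; rewrite negbK => /eqP ->.
    rewrite scaler_sumr; under eq_bigr do rewrite scalerA; over.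
  rewrite exchange_big big1//= => i _; rewrite -scaler_suml.
  have /matrixP/(_ 0 i) := aA; rewrite !mxE => Ai.
  rewrite (_ : \sum_(j < n) _ = 0) ?scale0r// -[RHS]Ai.
  by apply: eq_bigr => j _; rewrite !mxE.
move/vfree => a00; move/eqP: a0; apply; apply/rowP => j.
by rewrite a00 mxE.
Qed.

(** Induction on [k]: an orthonormal family of [k < n] vectors cannot span all
the [v j], so one of them has a nonzero remainder to be normalised. *)
Lemma orthonormal_in_subspace (L : set V) n (v : 'I_n -> V) k :
  submod_closed [in L] -> lin_indep v -> (forall i, L (v i)) -> (k <= n)%N ->
  exists e : 'I_k -> V,
    (forall i, L (e i)) /\ forall i j, ip (e i) (e j) = (i == j)%:R.
Proof.
move=> Lsub vfree Lv; elim: k => [|k IH] kn.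
  by exists (fun=> 0); split; [case|case].
have [e [Le eE]] := IH (ltnW kn).
have [j vj] := lin_indep_notin_span e (fun j i => ip (v j) (e i)) vfree kn.
pose w := v j - \sum_i ip (v j) (e i) *: e i.
have w0 : 0 < `|w| by rewrite normr_gt0 subr_eq0.
have Lw : L w.
  rewrite /w addrC -scaleN1r; apply: set_mem; apply: (Lsub.2); apply/mem_set => //.
  exact: submod_closed_sum.
have we i : ip w (e i) = 0.
  rewrite /w ipDl -scaleN1r ipZl ip_suml (bigD1 i)//= eE eqxx mulr1.
  rewrite big1 ?addr0 ?mulN1r ?subrr// => l li.
  by rewrite eE (negbTE li) mulr0.
pose e' (i : 'I_k.+1) := oapp e (`|w|^-1 *: w) (unlift ord_max i).
exists e'; split => [i|i l]; rewrite /e'.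
  case: unliftP => [i' _|_] /=; first exact: Le.
  by apply: set_mem; rewrite -[_ *: _]addr0; apply: (Lsub.2); [exact/mem_set|exact: Lsub.1].
case: unliftP => [i' ->|->] /=; case: unliftP => [l' ->|->] /=.
- by rewrite eE (inj_eq (@lift_inj _ _)).
- by rewrite ipZr ipC we mulr0 eq_sym (negbTE (neq_lift _ _)).
- by rewrite ipZl we mulr0 (negbTE (neq_lift _ _)).
- by rewrite ipZl ipZr hilb eqxx expr2 mulKf ?gt_eqF// mulVf ?gt_eqF.
Qed.

Lemma orthonormal_norm_sum n (e : 'I_n -> V) (c : 'I_n -> R) :
  (forall i j, ip (e i) (e j) = (i == j)%:R) ->
  `|\sum_i c i *: e i| ^+ 2 = \sum_i c i ^+ 2.
Proof.
move=> eE; rewrite -hilb ip_suml; apply: eq_bigr => i _.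
rewrite ipC ip_suml (bigD1 i)//= eE eqxx mulr1 big1 ?addr0 ?expr2// => j ji.
by rewrite eE (negbTE ji) mulr0.
Qed.

End gram_schmidt.

(** * A second order Taylor inequality *)

Section taylor.
Context (R : realType) (V : normedModType R).

Lemma clin_le (W : normedModType R) (f : 'L(V, W)) v : `|f v| <= `|f| * `|v|.
Proof. exact: opnormP. Qed.

Section evaluation.
Context (W : normedModType R) (h : V).

Definition evalL (f : 'L(V, W)) : W := f h.

Lemma evalL_linear : linear evalL.
Proof. by []. Qed.

HB.instance Definition _ := GRing.isLinear.Build R 'L(V, W) W _ evalL evalL_linear.

Lemma evalL_continuous : continuous evalL.
Proof.
apply/linear_bounded_continuous/bounded_funP => r; exists (r * `|h|) => f fr.
by rewrite (le_trans (clin_le _ _))// ler_wpM2r.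
Qed.

End evaluation.

(** Restricting to lines reduces the mean value arguments to one variable. *)
Lemma is_derive_line (W : normedModType R) (f : V -> W) (u h : V) (s : R) :
  (forall x, differentiable f x) ->
  is_derive s 1 (fun s : R => f (u + s *: h)) (frechet f (u + s *: h) h).
Proof.
move=> df.
have dg : is_diff s (fun s : R => u + s *: h) (fun s : R => s *: h).
  have /= := is_diffD (is_diff_cst u s) (is_diff_scalel s h).
  by rewrite add0r.
have dfg := is_diff_comp dg (differentiableP (df (u + s *: h))).
apply: DeriveDef; first exact/derivable1_diffP/ex_diff.
by rewrite deriveE ?(@diff_val _ _ _ _ _ _ _ dfg)/= ?scale1r ?frechetE.
Qed.


(** The difference [K] of the two sides along the segment has [K' = K1] with
[K1 0 = 0] and [K1' = K2 >= 0], so two applications of the mean value theorem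
give [K 0 <= K 1]. *)
Lemma taylor2_real (f0 f1 f2 : R -> R) (C : R) :
  (forall s : R, is_derive s 1 f0 (f1 s)) ->
  (forall s : R, is_derive s 1 f1 (f2 s)) ->
  (forall s, 0 <= s <= 1 -> f2 s <= C) ->
  f0 1 <= f0 0 + f1 0 + C / 2.
Proof.
move=> d0 d1 f2C.
pose K1 : R -> R := cst (f1 0) + C *: (id : R -> R) - f1.
pose K2 (s : R) : R := C - f2 s.
pose K : R -> R := f1 0 *: (id : R -> R)
  + (C / 2) *: ((id : R -> R) * (id : R -> R)) - f0.
have K1D (s : R) : is_derive s 1 K1 (K2 s).
  apply: (is_derive_eq (is_deriveB (is_deriveD (is_derive_cst (f1 0) s 1)
    (is_deriveZ C (is_derive_id s 1))) (d1 s))).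
  by rewrite add0r /GRing.scale/= mulr1.
have KD (s : R) : is_derive s 1 K (K1 s).
  have didid := is_deriveM (is_derive_id s 1) (is_derive_id s 1).
  apply: (is_derive_eq (is_deriveB (is_deriveD (is_deriveZ (f1 0) (is_derive_id s 1))
    (is_deriveZ (C / 2) didid)) (d0 s))).
  have -> : K1 s = f1 0 + C * s - f1 s by [].
  by rewrite /GRing.scale/=; field.
have contK (f g : R -> R) : (forall s : R, is_derive s 1 f (g s)) -> continuous f.
  move=> fg t; apply/differentiable_continuous/derivable1_diffP.
  by case: (fg t).
have [c + KE] := MVT_segment ler01 (fun s _ => KD s)
  (continuous_subspaceT (contK _ _ KD)).
rewrite in_itv/= => /andP[c0 c1].
have [c' + K1E] := MVT_segment c0 (fun s _ => K1D s)
  (continuous_subspaceT (contK _ _ K1D)).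
rewrite in_itv/= => /andP[c'0 c'c].
have K10 : K1 0 = 0 by rewrite /K1 !fctE scaler0 addr0 subrr.
have {}KE : 0 <= K 1 - K 0.
  rewrite KE subr0 mulr1; move: K1E; rewrite K10 !subr0 => ->.
  by rewrite mulr_ge0// subr_ge0 f2C// c'0 (le_trans c'c).
move: KE; rewrite /K !fctE /GRing.scale/= !mulr1 !mulr0; lra.
Qed.

Lemma taylor2_le (phi : V -> R) (u h : V) (tau : R) :
  C2 phi ->
  (forall s, 0 <= s <= 1 ->
     `|frechet (frechet phi) (u + s *: h) - frechet (frechet phi) u| <= tau) ->
  phi (u + h) <= phi u + frechet phi u h
    + (frechet (frechet phi) u h h + tau * `|h| ^+ 2) / 2.
Proof.
move=> [[dphi _] [ddphi _]] htau.
have dline (s : R) : is_derive s 1 (fun s => frechet phi (u + s *: h) h)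
    (frechet (frechet phi) (u + s *: h) h h).
  have lind x : differentiable (evalL h : 'L(V, R) -> R) x.
    by apply: linear_differentiable; exact: evalL_continuous.
  have dcomp x : differentiable (evalL h \o frechet phi) x.
    by apply: differentiable_comp.
  apply: is_derive_eq; first exact: (is_derive_line u h s dcomp).
  rewrite frechetE// diff_comp// diff_lin; last exact: evalL_continuous.
  by rewrite /= /evalL -frechetE.
have := taylor2_real (fun s => is_derive_line u h s dphi) dline.
rewrite !scale1r !scale0r !addr0; apply => s /htau {}htau.
rewrite -lerBlDl [leLHS](_ : _ = (frechet (frechet phi) (u + s *: h)
  - frechet (frechet phi) u) h h)// (le_trans (ler_norm _))//.
rewrite (le_trans (clin_le _ _))// expr2 mulrA ler_wpM2r//.
by rewrite (le_trans (clin_le _ _))// ler_wpM2r.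
Qed.

End taylor.

(** * Expansion along curves on the sphere *)

Section holder_bounds.
Context (R : realType) (V : normedModType R) (phi : V -> R) (alpha : R).
Hypothesis alpha_gt0 : 0 < alpha.
Hypothesis phiH : holder_on_bounded_sets alpha phi.

Let ball0 (K : R) (u : V) : `|u| <= K -> ball 0 (`|K| + 1) u.
Proof.
move=> uK; rewrite -ball_normE /ball_ /= sub0r normrN.
by rewrite (le_lt_trans uK)// (le_lt_trans (ler_norm _))// ltrDl.
Qed.

Lemma holder_unif_cont K tau : 0 < tau -> exists2 r, 0 < r &
  forall u w, `|u| <= K -> `|w| <= K -> `|u - w| <= r ->
    `|frechet phi u - frechet phi w| <= tau /\
    `|frechet (frechet phi) u - frechet (frechet phi) w| <= tau.
Proof.
move=> tau0; have K1 : 0 < `|K| + 1 by rewrite ltr_wpDl.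
have [M M0 hM] := phiH K1.
pose r := (tau / M) `^ alpha^-1.
exists r => [|u w uK wK uw]; first by rewrite powR_gt0 // divr_gt0.
have : M * `|u - w| `^ alpha <= tau.
  rewrite mulrC -ler_pdivlMr// (@le_trans _ _ (r `^ alpha))//.
    by rewrite ge0_ler_powR// ?nnegrE ?powR_ge0// ltW.
  by rewrite -powRrM mulVf ?gt_eqF// powRr1// divr_ge0 ?ltW.
have [h1 h2] := hM u w (ball0 uK) (ball0 wK).
by move=> h; split; [exact: le_trans h1 _|exact: le_trans h2 _].
Qed.

Lemma holder_bounded K : exists2 N, 0 < N & forall u, `|u| <= K ->
  `|frechet phi u| <= N /\ `|frechet (frechet phi) u| <= N.
Proof.
have K1 : 0 < `|K| + 1 by rewrite ltr_wpDl.
have [M M0 hM] := phiH K1.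
pose P := M * (`|K| + 1) `^ alpha.
have P0 : 0 <= P by rewrite mulr_ge0 ?powR_ge0// ltW.
exists (P + (`|frechet phi 0| + (`|frechet (frechet phi) 0| + 1))).
  by rewrite ltr_wpDl// !addr_ge0.
move=> u uK; have u0 : ball 0 (`|K| + 1) (0 : V) by exact: ballxx.
have [h1 h2] := hM u 0 (ball0 uK) u0.
have uP : M * `|u - 0| `^ alpha <= P.
  rewrite ler_pM2l// subr0 ge0_ler_powR ?nnegrE ?(ltW alpha_gt0) ?(ltW K1)//.
  by rewrite (le_trans uK)// (le_trans (ler_norm K))// lerDl.
have tri (W : normedModType R) (x y : W) : `|x - y| <= P -> `|x| <= P + `|y|.
  by move=> xy; rewrite -{1}[x](subrK y) (le_trans (ler_normD _ _))// lerD2r.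
have {h1}n1 := tri _ _ _ (le_trans h1 uP); have {h2}n2 := tri _ _ _ (le_trans h2 uP).
split; [apply: (le_trans n1)|apply: (le_trans n2)]; rewrite lerD2l.
  by rewrite lerDl addr_ge0.
by rewrite ler_wpDl// lerDl.
Qed.

End holder_bounds.

Section clin_arith.
Context (R : realType) (V : normedModType R).
Implicit Types (f g : 'L(V, R)) (F G : 'L(V, 'L(V, R))).

Lemma clinZ f a u : f (a *: u) = a * f u.
Proof. exact: linearZ. Qed.

Lemma clinBl f g u : (f - g) u = f u - g u. Proof. by []. Qed.

Lemma clinD f u v : f (u + v) = f u + f v.
Proof. exact: linearD. Qed.

Lemma clinB f u v : f (u - v) = f u - f v.
Proof. exact: linearB. Qed.

Lemma clin2D F u v w : F (u + v) w = F u w + F v w.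
Proof. by rewrite linearD. Qed.

Lemma clin_diff f g u z : f (u + z) - g u = f z + (f - g) u.
Proof. by rewrite clinD clinBl; ring. Qed.

Lemma clin2_diff F G u z :
  F (u + z) (u + z) - G u u = F z (u + z) + F u z + (F - G) u u.
Proof. by rewrite clin2D [F u _]clinD !clinBl; ring. Qed.

Lemma clin_bound f N v : `|f| <= N -> `|f v| <= N * `|v|.
Proof. by move=> fN; rewrite (le_trans (clin_le _ _))// ler_wpM2r. Qed.

Lemma clin2_bound F N v w : `|F| <= N -> `|F v w| <= N * (`|v| * `|w|).
Proof.
move=> FN; rewrite (le_trans (clin_le _ _))// mulrA ler_wpM2r//.
by rewrite (le_trans (clin_le _ _))// ler_wpM2r.
Qed.

End clin_arith.

Section sphere_taylor.
Context (R : realType) (E : completeNormedModType R) (b : E -> E -> R).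
Hypothesis bform : contractive_form b.
Variable mu : R.
Hypothesis mu_gt0 : 0 < mu.
Context (phi : E -> R) (alpha : R).
Hypothesis alpha_gt0 : 0 < alpha.
Hypothesis phiC2 : C2 phi.
Hypothesis phiH : holder_on_bounded_sets alpha phi.

Local Notation dphi := (frechet phi).
Local Notation ddphi := (frechet (frechet phi)).
Local Notation tproj := (tproj b mu).
Local Notation slide := (slide b mu).

(** The displacement [slide u v - u] equals [v / (1 + q)] minus a multiple of
[u] of second order in [v]; the effect of the latter on [phi'] is the Lagrange
multiplier part of the constrained Hessian, and everything else is of third
order. *)
Lemma slide_taylor K tau : 0 <= K -> 0 < tau -> exists2 s0, 0 < s0 &
  forall u v, `|u| <= K -> b u u = mu -> b u v = 0 -> `|v| <= s0 ->
  phi (slide u v) <= phi u + dphi u v / (1 + b v v / (4 * mu))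
    + (ddphi u v v - dphi u u / mu * b v v) / 2 + tau * `|v| ^+ 2.
Proof.
move=> K0 tau0.
have [N N0 bdN] := holder_bounded alpha_gt0 phiH (K + 2).
have tau4 : 0 < tau / 4 by lra.
have [r r0 unif] := holder_unif_cont alpha_gt0 phiH (K + 2) tau4.
pose C := N * K / (8 * mu ^+ 2) + 3 * N * (1 + 2 * K) / (8 * mu).
have C0 : 0 <= C.
  by rewrite !(addr_ge0, mulr_ge0, invr_ge0, exprn_ge0, (ltW N0), (ltW mu_gt0)).
pose s0 := Num.min (Num.min 1 (r / 2))
  (Num.min (2 * mu / (K + 1)) (tau / (2 * (C + 1)))).
exists s0.
  rewrite !lt_min ltr01 !divr_gt0//= ?mulr_gt0//; lra.
move=> u v uK uu uv; rewrite /s0 !le_min => /andP[/andP[v1 vr] /andP[vK vC]].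
have vK' : `|v| * K <= 2 * mu.
  move: vK; rewrite ler_pdivlMr ?ltr_wpDl// mulrDr mulr1.
  have := normr_ge0 v; lra.
have hn := slide_dist bform mu_gt0 uK vK'.
have hE := slideBE bform mu_gt0 u v.
set q := b v v / (4 * mu) in hE *; set h := slide u v - u in hn hE.
set x := `|v| in v1 vr vK vC vK' hn *.
have x0 : 0 <= x by exact: normr_ge0.
have q0 : 0 <= q by rewrite divr_ge0 ?form_ge0// mulr_ge0// ltW.
have q1 : 0 < 1 + q by lra.
have qx : q <= x ^+ 2 / (4 * mu).
  by rewrite ler_wpM2r ?form_sqr_le// invr_ge0 mulr_ge0// ltW.
have bvv : b v v = 4 * mu * q by rewrite /q; field; rewrite gt_eqF.
clearbody q.
pose w := h - v.
have wE : w = (1 + q)^-1 *: (- q *: (v + 2 *: u)).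
  apply: (scalerI (lt0r_neq0 q1)); rewrite /w hE scalerBr !scalerA.
  rewrite divff ?gt_eqF// !scale1r mul1r [(1 + q) *: v]scalerDl scale1r opprD.
  by rewrite addrACA subrr add0r addrC scaleNr scalerDr scalerA opprD (mulrC q).
have q1inv : 0 <= (1 + q)^-1 <= 1.
  by rewrite invr_ge0 ltW//= invf_le1// lerDl.
have wle : `|w| <= q * (x + 2 * K).
  rewrite wE !normrZ normrN (ger0_norm q0) ger0_norm; last by case/andP: q1inv.
  rewrite (@le_trans _ _ (q * `|v + 2 *: u|))//.
    by rewrite ler_piMl ?mulr_ge0//; case/andP: q1inv.
  rewrite ler_wpM2l// (le_trans (ler_normD _ _))// lerD2l normrZ.
  by rewrite ger0_norm// ler_wpM2l.
have [d1N d2N] : `|dphi u| <= N /\ `|ddphi u| <= N by apply: bdN; lra.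
have T : phi (u + h) <= phi u + dphi u h + (ddphi u h h + tau / 4 * `|h| ^+ 2) / 2.
  apply: taylor2_le => // s /andP[s0' s1].
  have sh : `|s *: h| <= 2 * x.
    by rewrite normrZ ger0_norm// (le_trans _ hn)// ler_piMl.
  apply: (unif _ _ _ _ _).2.
  - by rewrite (le_trans (ler_normD _ _))//; lra.
  - by lra.
  - by rewrite addrC addKr (le_trans sh)//; lra.
have uh : u + h = slide u v by rewrite /h addrC subrK.
rewrite uh in T; apply: (le_trans T) => {T uh unif bdN}.
have dE : dphi u h = dphi u v / (1 + q) - 2 * q / (1 + q) * dphi u u.
  by rewrite hE clinZ clinB clinZ; field; rewrite gt_eqF.
have hvw : h = v + w by rewrite /w addrC subrK.
have ddE : ddphi u h h = ddphi u v v + ddphi u v w + ddphi u w h.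
  by rewrite {1}hvw clin2D {1}hvw clinD.
have e1 : ddphi u v w <= N * (x * `|w|).
  by rewrite (le_trans (ler_norm _))// clin2_bound.
have e2 : ddphi u w h <= N * (`|w| * (2 * x)).
  rewrite (le_trans (ler_norm _))// (le_trans (clin2_bound _ _ d2N))//.
  by rewrite ler_wpM2l ?(ltW N0)// ler_wpM2l.
have e3 : `|dphi u u| <= N * K.
  by rewrite (le_trans (clin_bound _ d1N))// ler_wpM2l// ltW.
have hh : `|h| ^+ 2 <= 4 * x ^+ 2.
  rewrite (_ : 4 * x ^+ 2 = (2 * x) ^+ 2); last by ring.
  by rewrite ler_pXn2r// ?nnegrE ?mulr_ge0.
have f1 : 2 * q * dphi u u - 2 * q / (1 + q) * dphi u u <= 2 * q ^+ 2 * (N * K).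
  rewrite [leLHS](_ : _ = 2 * q ^+ 2 * ((1 + q)^-1 * dphi u u)); last first.
    by field; rewrite gt_eqF.
  rewrite ler_wpM2l ?mulr_ge0 ?exprn_ge0//.
  rewrite (le_trans (ler_norm _))// normrM ger0_norm; last by case/andP: q1inv.
  by rewrite (le_trans _ e3)// ler_piMl//; case/andP: q1inv.
have f2 : 2 * q ^+ 2 * (N * K) <= N * K / (8 * mu ^+ 2) * x ^+ 3.
  rewrite [leRHS](_ : _ = 2 * (x ^+ 3 / (16 * mu ^+ 2)) * (N * K)); last first.
    by field; rewrite gt_eqF.
  rewrite ler_wpM2r ?mulr_ge0 ?(ltW N0)// ler_wpM2l//.
  rewrite (@le_trans _ _ ((x ^+ 2 / (4 * mu)) ^+ 2))//.
    by rewrite ler_pXn2r// ?nnegrE// !(mulr_ge0, invr_ge0, exprn_ge0, (ltW mu_gt0)).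
  rewrite [leLHS](_ : _ = x * (x ^+ 3 / (16 * mu ^+ 2))); last first.
    by field; rewrite gt_eqF.
  by rewrite ler_piMl// !(mulr_ge0, invr_ge0, exprn_ge0, (ltW mu_gt0)).
have f3 : 3 / 2 * N * x * `|w| <= 3 * N * (1 + 2 * K) / (8 * mu) * x ^+ 3.
  rewrite [leRHS](_ : _ = 3 / 2 * N * x * (x ^+ 2 / (4 * mu) * (1 + 2 * K))); last first.
    by field; rewrite gt_eqF.
  rewrite ler_wpM2l//; first by rewrite !(mulr_ge0, invr_ge0, (ltW N0)).
  rewrite (le_trans wle)// ler_pM ?addr_ge0 ?mulr_ge0//.
  by rewrite lerD2r.
have f4 : C * x ^+ 3 <= tau / 2 * x ^+ 2.
  rewrite [leLHS](_ : _ = C * x * x ^+ 2); last by ring.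
  rewrite ler_wpM2r ?exprn_ge0//.
  move: vC; rewrite ler_pdivlMr; last by lra.
  by nra.
have CE : C * x ^+ 3 = N * K / (8 * mu ^+ 2) * x ^+ 3
    + 3 * N * (1 + 2 * K) / (8 * mu) * x ^+ 3 by rewrite /C mulrDl.
have ge : dphi u u / mu * b v v = 4 * q * dphi u u.
  by rewrite bvv; field; rewrite gt_eqF.
rewrite dE ddE ge.
set A := dphi u u in f1 *; set X := dphi u v / _; set Y := 2 * q / (1 + q) * A in f1 *.
have tauh : tau / 4 * `|h| ^+ 2 <= tau / 4 * (4 * x ^+ 2) by rewrite ler_wpM2l// ltW.
have g1 : N * (x * `|w|) = N * x * `|w| by ring.
have g2 : N * (`|w| * (2 * x)) = 2 * (N * x * `|w|) by ring.
have g3 : 3 / 2 * N * x * `|w| = 3 / 2 * (N * x * `|w|) by ring.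
have g4 : 2 * q * A = 2 * (q * A) by ring.
have g5 : 4 * q * A = 4 * (q * A) by ring.
have g6 : tau / 4 * (4 * x ^+ 2) = tau * x ^+ 2 by field.
have g7 : tau / 2 * x ^+ 2 = tau * x ^+ 2 / 2 by ring.
rewrite g1 in e1; rewrite g2 in e2; rewrite g3 in f3; rewrite g4 in f1.
rewrite g5; rewrite g6 in tauh; rewrite g7 in f4.
lra.
Qed.

End sphere_taylor.

Section transport.
Context (R : realType) (E : completeNormedModType R) (b : E -> E -> R).
Hypothesis bform : contractive_form b.
Variable mu : R.
Hypothesis mu_gt0 : 0 < mu.
Context (phi : E -> R) (alpha : R).
Hypothesis alpha_gt0 : 0 < alpha.
Hypothesis phiC2 : C2 phi.
Hypothesis phiH : holder_on_bounded_sets alpha phi.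

Local Notation dphi := (frechet phi).
Local Notation ddphi := (frechet (frechet phi)).
Local Notation tproj := (tproj b mu).
Local Notation slide := (slide b mu).

(** The Hessian of [phi] constrained to the sphere, at a point [u] with
[b u u = mu]: the second term is the Lagrange multiplier correction. *)
Definition sphere_hess (u v : E) : R := ddphi u v v - dphi u u / mu * b v v.

(** The descent directions found at [u0] have to serve at all points of a ball
around it, whose radius depends only on bounds for the derivatives of [phi] and
not on [u0].  There [tproj u e - e] is small compared with [e], and the
derivatives of [phi] are uniformly continuous. *)
Lemma transport_close K tau : 0 <= K -> 0 < tau -> exists2 r, 0 < r &
  forall u0 u e, `|u0| <= K -> `|u - u0| <= r -> b u0 e = 0 ->
  [/\ `|tproj u e| <= 2 * `|e|,
      `|dphi u (tproj u e) - dphi u0 e| <= tau * `|e| &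
      sphere_hess u (tproj u e) <= sphere_hess u0 e + tau * `|e| ^+ 2].
Proof.
move=> K0 tau0.
have [N N0 bdN] := holder_bounded alpha_gt0 phiH (K + 1).
pose C2 := 1 + K / mu.
pose L := (K + 1) / mu.
have L0 : 0 < L by rewrite divr_gt0//; lra.
have C21 : 1 <= C2 by rewrite lerDl divr_ge0// ltW.
pose C1 := 3 * N * L + 3 * N * L * L + N / mu.
have C10 : 0 <= C1.
  by rewrite !(addr_ge0, mulr_ge0, invr_ge0, (ltW N0), (ltW mu_gt0), (ltW L0)).
pose tau' := tau / (2 * C2).
have tau'0 : 0 < tau' by rewrite divr_gt0// mulr_gt0//; lra.
have [r r0 unif] := holder_unif_cont alpha_gt0 phiH (K + 1) tau'0.
exists (Num.min (Num.min 1 r) (Num.min (L^-1) (tau / (2 * (C1 + 1))))).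
  rewrite !lt_min ltr01 r0 invr_gt0 L0 divr_gt0//= mulr_gt0//; lra.
move=> u0 u e u0K; set d := `|u - u0|.
rewrite !le_min => /andP[/andP[d1 dr] /andP[dL dC]] u0e.
have d0 : 0 <= d by exact: normr_ge0.
have uK : `|u| <= K + 1.
  by rewrite -[u](subrK u0) (le_trans (ler_normD _ _))// addrC lerD.
set x := `|e|; have x0 : 0 <= x by exact: normr_ge0.
pose z := tproj u e - e.
have zle : `|z| <= d * L * x by exact: tproj_dist.
have dL1 : d * L <= 1 by rewrite -ler_pdivlMr// mul1r.
have dL0 : 0 <= d * L by rewrite mulr_ge0// ltW.
have zx : `|z| <= x by rewrite (le_trans zle)// ler_piMl.
have tE : tproj u e = e + z by rewrite /z addrC subrK.
have tle : `|tproj u e| <= 2 * x.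
  by rewrite tE (le_trans (ler_normD _ _))// -/x; lra.
clearbody z.
have [d1N d2N] := bdN _ uK.
have u0K1 : `|u0| <= K + 1 by lra.
have [t1 t2] := unif _ _ uK u0K1 dr.
have C1d : d * C1 <= tau / 2.
  move: dC; rewrite ler_pdivlMr; last by lra.
  nra.
have C2t : tau' * C2 = tau / 2.
  by rewrite /tau'; field; rewrite gt_eqF//; lra.
have NLd : N * (d * L) + tau' <= tau.
  have : tau' <= tau' * C2 by rewrite ler_peMr// ltW.
  have : N * (d * L) <= d * C1.
    rewrite /C1 !mulrDr.
    have p1 : 0 <= d * (3 * N * L * L) by rewrite !(mulr_ge0, (ltW N0), (ltW L0)).
    have p2 : 0 <= d * (N / mu) by rewrite !(mulr_ge0, invr_ge0, (ltW N0), (ltW mu_gt0)).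
    have p3 : 0 <= N * (d * L) by rewrite mulr_ge0// ltW.
    have p4 : d * (3 * N * L) = 3 * (N * (d * L)) by ring.
    lra.
  lra.
split=> //.
  rewrite tE clin_diff.
  rewrite (le_trans (ler_normD _ _))// (@le_trans _ _ ((N * (d * L) + tau') * x))//.
    rewrite mulrDl lerD//; last exact: clin_bound.
    by rewrite (le_trans (clin_bound _ d1N))// -mulrA ler_wpM2l// ltW.
  by rewrite ler_wpM2r.
have E1 : ddphi u (tproj u e) (tproj u e) - ddphi u0 e e =
    ddphi u z (tproj u e) + ddphi u e z + (ddphi u - ddphi u0) e e.
  by rewrite tE clin2_diff.
have E2 : b (tproj u e) (tproj u e) - b e e = b z (tproj u e) + b e z.
  by rewrite tE !(formDl bform, formDr bform); ring.
have E3 : dphi u u * b (tproj u e) (tproj u e) - dphi u0 u0 * b e e =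
    dphi u u * (b z (tproj u e) + b e z)
    + (dphi u (u - u0) + (dphi u - dphi u0) u0) * b e e.
  have aux (p p' q q' w1 w2 : R) : w1 = q - q' -> w2 = p - p' ->
    p * q - p' * q' = p * w1 + w2 * q' by move=> -> ->; ring.
  apply: aux; first by rewrite E2.
  by rewrite -(clin_diff (dphi u) (dphi u0) u0 (u - u0)) (addrC u0 (u - u0)) (subrK u0 u).
have X2 : 0 <= x ^+ 2 by rewrite exprn_ge0.
have F1 : ddphi u (tproj u e) (tproj u e) - ddphi u0 e e <=
    (3 * N * (d * L) + tau') * x ^+ 2.
  rewrite E1 [leRHS](_ : _ = N * (d * L * x * (2 * x)) + N * (x * (d * L * x))
    + tau' * (x * x)); last by ring.
  rewrite !lerD// (le_trans (ler_norm _))//.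
  - by rewrite (le_trans (clin2_bound _ _ d2N))// ler_wpM2l ?(ltW N0)// ler_pM.
  - by rewrite (le_trans (clin2_bound _ _ d2N))// ler_wpM2l ?(ltW N0)// ler_wpM2l.
  - exact: clin2_bound.
have F2 : `|b z (tproj u e) + b e z| <= 3 * (d * L) * x ^+ 2.
  rewrite [leRHS](_ : _ = d * L * x * (2 * x) + x * (d * L * x)); last by ring.
  rewrite (le_trans (ler_normD _ _))// lerD// (le_trans (form_le bform _ _))//.
    by rewrite ler_pM.
  by rewrite ler_wpM2l.
have F3 : `|dphi u (u - u0) + (dphi u - dphi u0) u0| <= N * d + tau' * K.
  rewrite (le_trans (ler_normD _ _))// lerD//; first exact: clin_bound.
  by rewrite (le_trans (clin_bound _ t1))// ler_wpM2l// ltW.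
have F4 : `|dphi u u| <= N * (K + 1).
  by rewrite (le_trans (clin_bound _ d1N))// ler_wpM2l// ltW.
have F5 : `|dphi u u * b (tproj u e) (tproj u e) - dphi u0 u0 * b e e| <=
    (N * (K + 1) * (3 * (d * L)) + N * d + tau' * K) * x ^+ 2.
  rewrite [leRHS](_ : _ = N * (K + 1) * (3 * (d * L) * x ^+ 2)
    + (N * d + tau' * K) * x ^+ 2); last by ring.
  rewrite E3 (le_trans (ler_normD _ _))// !normrM lerD//; first exact: ler_pM.
  rewrite ler_pM// ger0_norm ?form_sqr_le//; exact: form_ge0.
have F6 : - ((dphi u u * b (tproj u e) (tproj u e) - dphi u0 u0 * b e e) / mu) <=
    (N * (K + 1) * (3 * (d * L)) + N * d + tau' * K) * x ^+ 2 / mu.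
  rewrite -mulNr ler_wpM2r ?invr_ge0 ?(ltW mu_gt0)//.
  by rewrite (le_trans _ F5)// -normrN ler_norm.
have F7 : (3 * N * (d * L) + tau') * x ^+ 2
    + (N * (K + 1) * (3 * (d * L)) + N * d + tau' * K) * x ^+ 2 / mu
    = (d * C1 + tau' * C2) * x ^+ 2.
  by rewrite /C1 /C2 /L; field; rewrite gt_eqF.
have F8 : (d * C1 + tau' * C2) * x ^+ 2 <= tau * x ^+ 2.
  by rewrite ler_wpM2r// C2t [leRHS]splitr lerD2r.
have F9 : sphere_hess u (tproj u e) - sphere_hess u0 e =
    (ddphi u (tproj u e) (tproj u e) - ddphi u0 e e)
    - (dphi u u * b (tproj u e) (tproj u e) - dphi u0 u0 * b e e) / mu.
  have aux (p p' q q' s s' : R) : (s - p / mu * q) - (s' - p' / mu * q') =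
    (s - s') - (p * q - p' * q') / mu by field; rewrite gt_eqF.
  exact: aux.
rewrite -lerBlDl F9; apply: le_trans F8; rewrite -F7; exact: lerD.
Qed.

End transport.

(** * Local descent *)

Section scalar.
Context (R : realType).
Implicit Types x q e delta s C T l m z : R.

Lemma steep_close l m delta : m < - delta -> l - m <= delta / 4 ->
  l <= - (3 * delta / 4).
Proof. lra. Qed.

Lemma steep_sum l m z delta : l <= - (3 * delta / 4) -> - l <= z - m ->
  m <= z - 3 * delta / 4.
Proof. lra. Qed.

Lemma steep_gain x q e delta s C T : 0 <= q <= 1 -> 0 <= e -> 0 < delta ->
  x <= e - 3 * delta / 4 -> 0 <= s <= 1 -> s * (C + delta) <= delta / 4 ->
  T <= s ^+ 2 * C -> s * (x / (1 + q)) + T <= e - delta / 4 * s ^+ 2.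
Proof.
move=> /andP[q0 q1] e0 delta0 xle /andP[s0 s1] sC Tle.
have xq : x / (1 + q) <= e - 3 * delta / 8.
  rewrite ler_pdivrMr; last by lra.
  have qe : 0 <= q * e by rewrite mulr_ge0.
  have qd : q * delta <= delta by rewrite ler_piMl// ltW.
  nra.
have sx : s * (x / (1 + q)) <= s * (e - 3 * delta / 8) by rewrite ler_wpM2l.
have se : s * e <= e by rewrite ler_piMl.
have ss : s * (s * (C + delta)) <= s * (delta / 4) by rewrite ler_wpM2l.
have sd : 0 <= s ^+ 2 * delta by rewrite mulr_ge0 ?exprn_ge0// ltW.
have sd1 : 0 <= s * delta by rewrite mulr_ge0// ltW.
nra.
Qed.

Lemma saddle_gain x q e delta s y z w : 0 <= q -> 0 <= e -> 0 < delta ->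
  x <= e -> 0 <= s <= 1 -> 1 <= y -> z <= - delta * y + delta / 4 * y ->
  w <= 4 * y ->
  s * (x / (1 + q)) + s ^+ 2 * (z / 2) + delta / 32 * (s ^+ 2 * w)
    <= e - delta / 4 * s ^+ 2.
Proof.
move=> q0 e0 delta0 xe /andP[s0 s1] y1 zy wy.
have xq : x / (1 + q) <= e.
  rewrite ler_pdivrMr; last by lra.
  have qe : 0 <= q * e by rewrite mulr_ge0.
  nra.
have sx : s * (x / (1 + q)) <= s * e by rewrite ler_wpM2l.
have se : s * e <= e by rewrite ler_piMl.
have s2 : 0 <= s ^+ 2 by rewrite exprn_ge0.
have h1 : s ^+ 2 * (z / 2) <= s ^+ 2 * ((- delta * y + delta / 4 * y) / 2).
  by rewrite ler_wpM2l// ler_wpM2r.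
have h2 : delta / 32 * (s ^+ 2 * w) <= delta / 32 * (s ^+ 2 * (4 * y)).
  by rewrite ler_wpM2l ?ler_wpM2l//; lra.
have h3 : 0 <= s ^+ 2 * delta * (y - 1).
  by rewrite mulr_ge0 ?subr_ge0// mulr_ge0// ltW.
nra.
Qed.

End scalar.

Section local_descent.
Context (R : realType) (E : completeNormedModType R) (b : E -> E -> R).
Hypothesis bform : contractive_form b.
Variable mu : R.
Hypothesis mu_gt0 : 0 < mu.
Context (ip : {dot E for (@idfun R)}).
Hypothesis hilb : hilbert ip.
Context (phi : E -> R) (alpha : R).
Hypothesis alpha_gt0 : 0 < alpha.
Hypothesis phiC2 : C2 phi.
Hypothesis phiH : holder_on_bounded_sets alpha phi.
Variable d : nat.

Local Notation dphi := (frechet phi).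
Local Notation ddphi := (frechet (frechet phi)).
Local Notation tproj := (tproj b mu).
Local Notation slide := (slide b mu).
Local Notation sphere_hess := (sphere_hess b mu phi).
Local Notation D := (d.+1%:R : R).

(** The vectors [e i] can be combined with arbitrary coefficients [c i], as long
as each signed vector [c i *: e i] has slope at most [eta] and one coefficient is
as large as possible.  In this form the property holds both near a steep point,
where all the [e i] are equal, and near a saddle point, and leaves the choice of
the coefficients to a partition of the domain into cubes. *)
Definition descent_point (r s0 kappa eta0 : R) (u0 : E) :=
  exists e : 'I_d.+1 -> E, (forall i, `|e i| <= 1) /\
  forall u c eta s, b u u = mu -> `|u - u0| <= r -> 0 <= eta <= eta0 ->
    (forall i, `|c i| <= 1) -> (exists i, `|c i| = 1) ->
    (forall i, c i * dphi u (tproj u (e i)) <= eta) -> 0 <= s <= s0 ->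
    phi (slide u (s *: tproj u (\sum_i c i *: e i)))
      <= phi u + D * eta - kappa * s ^+ 2.

Definition steep (delta : R) (u0 : E) :=
  exists v, [/\ b u0 v = 0, `|v| <= 1 & dphi u0 v < - delta].

(** An approximate Morse index greater than [d], in an orthonormal form. *)
Definition saddle (delta : R) (u0 : E) :=
  exists e : 'I_d.+1 -> E,
    [/\ forall i, b u0 (e i) = 0,
        forall i j, ip (e i) (e j) = (i == j)%:R &
        forall c, let w := \sum_i c i *: e i in
          sphere_hess u0 w <= - delta * `|w| ^+ 2].

Lemma sphere_hessZ u s v : sphere_hess u (s *: v) = s ^+ 2 * sphere_hess u v.
Proof.
have aux (F : 'L(E, 'L(E, R))) : F (s *: v) (s *: v) = s ^+ 2 * F v v.
  by rewrite clinZ linearZ/= [X in s * X](_ : _ = s * F v v)// mulrA expr2.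
rewrite /sphere_hess (formZl bform) (formZr bform) aux.
have auxR (x p q : R) : s ^+ 2 * x - p * (s * (s * q)) = s ^+ 2 * (x - p * q) by ring.
exact: auxR.
Qed.

Lemma clin_sum (f : 'L(E, R)) n (c : 'I_n -> R) (e : 'I_n -> E) :
  f (\sum_i c i *: e i) = \sum_i c i * f (e i).
Proof. by rewrite linear_sum; apply: eq_bigr => i _; exact: clinZ. Qed.

Lemma form_sum0 u n (c : 'I_n -> R) (e : 'I_n -> E) :
  (forall i, b u (e i) = 0) -> b u (\sum_i c i *: e i) = 0.
Proof.
move=> e0; elim/big_ind : _ => [|x y x0 y0|i _].
- by have := formZr bform 0 0 u; rewrite scale0r mul0r.
- by rewrite (formDr bform) x0 y0 addr0.
- by rewrite (formZr bform) e0 mulr0.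
Qed.

(** Near a saddle point the first order term is at most [D * eta] by the sign
condition, and the quadratic gain is proportional to the squared norm of the
combination, which is at least one by orthonormality.  Near a steep point the
sign condition with [eta] small forces the coefficient of absolute value one to
be [1], and the linear gain beats the quadratic terms for short times. *)
Lemma descent_points K delta : 0 <= K -> 0 < delta ->
  exists r s0 kappa eta0 : R, [/\ 0 < r, 0 < s0 <= 1, 0 < kappa, 0 < eta0 &
  forall u0, `|u0| <= K -> b u0 u0 = mu -> steep delta u0 \/ saddle delta u0 ->
    descent_point r s0 kappa eta0 u0].
Proof.
move=> K0 delta0.
have D1 : 1 <= D by rewrite ler1n.
have K10 : 0 <= K + 1 by lra.
(* With these two errors the quadratic coefficient [- delta / 2] of a saddle
point degrades to [- delta / 4]. *)
have tau1_gt0 : 0 < delta / 32 by lra.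
have tau2_gt0 : 0 < delta / 4 by lra.
have [t t0 taylor] := slide_taylor bform mu_gt0 alpha_gt0 phiC2 phiH K10 tau1_gt0.
have [r2 r20 close] := transport_close bform mu_gt0 alpha_gt0 phiH K0 tau2_gt0.
have [N N0 bdN] := holder_bounded alpha_gt0 phiH (K + 1).
pose C3 := N + N * (K + 1) / mu.
have C30 : 0 <= C3 by rewrite !(addr_ge0, mulr_ge0, invr_ge0, (ltW N0), (ltW mu_gt0)).
(* [C4] bounds the quadratic terms near a steep point. *)
pose C4 := (C3 / 2 + delta / 32) * (4 * D ^+ 2).
have C40 : 0 <= C4.
  by rewrite mulr_ge0 ?mulr_ge0 ?exprn_ge0// addr_ge0// ?divr_ge0// ltW.
pose t' := Num.min t (Num.min 1 (4 * mu)).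
have t'0 : 0 < t' by rewrite !lt_min t0 ltr01 mulr_gt0.
exists (Num.min 1 r2), (Num.min 1 (Num.min (t' / (2 * D)) (delta / (4 * (C4 + delta))))),
  (delta / 4), (delta / 4).
split => //.
- by rewrite lt_min ltr01.
- rewrite ge_min lexx !lt_min ltr01 !divr_gt0//= mulr_gt0//; lra.
move=> u0 u0K u0S typ.
have main (e : 'I_d.+1 -> E) : (forall i, b u0 (e i) = 0) ->
  forall u c eta s, b u u = mu -> `|u - u0| <= Num.min 1 r2 ->
    0 <= eta <= delta / 4 ->
    (forall i, `|e i| <= 1) -> (forall i, `|c i| <= 1) ->
    (forall i, c i * dphi u (tproj u (e i)) <= eta) ->
    0 <= s <= Num.min 1 (Num.min (t' / (2 * D)) (delta / (4 * (C4 + delta)))) ->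
    let w := tproj u (\sum_i c i *: e i) in
    let q := b (s *: w) (s *: w) / (4 * mu) in
    [/\ 0 <= q <= 1,
        phi (slide u (s *: w)) <= phi u + s * (dphi u w / (1 + q))
          + s ^+ 2 * (sphere_hess u w / 2) + delta / 32 * (s ^+ 2 * `|w| ^+ 2),
        `|w| <= 2 * `|\sum_i c i *: e i|, `|w| <= 2 * D &
        dphi u w = \sum_i c i * dphi u (tproj u (e i))].
  move=> e0 u c eta s uS; rewrite le_min => /andP[ur1 ur2] _ e1 c1 ce.
  rewrite !le_min => /andP[s0 /andP[s1 /andP[st _]]].
  set y := \sum_i _ => w.
  have y0 : b u0 y = 0 by exact: form_sum0.
  have yD : `|y| <= D.
    rewrite (le_trans (ler_norm_sum _ _ _))//.
    rewrite [leRHS](_ : _ = \sum_(i < d.+1) (1 : R)); last first.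
      by rewrite sumr_const card_ord.
    by apply: ler_sum => i _; rewrite normrZ mulr_ile1.
  have uK : `|u| <= K + 1.
    by rewrite -[u](subrK u0) (le_trans (ler_normD _ _))// addrC lerD.
  have [wy _ _] := close u0 u y u0K ur2 y0.
  have wD : `|w| <= 2 * D by rewrite (le_trans wy)// ler_wpM2l.
  have svt' : `|s *: w| <= t'.
    rewrite normrZ ger0_norm//; move: st; rewrite ler_pdivlMr; last by lra.
    by apply: le_trans; rewrite ler_wpM2l.
  have [svt [sv1 sv4]] : `|s *: w| <= t /\ `|s *: w| <= 1 /\ `|s *: w| <= 4 * mu.
    by move: svt'; rewrite !le_min => /and3P[].
  have wS : b u w = 0 by exact: tproj_tangent.
  have := taylor u (s *: w) uK uS _ svt.
  rewrite (formZr bform) wS mulr0 -/(sphere_hess _ _) => /(_ erefl) T.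
  split=> //; last 2 first.
  - move: T; rewrite -/(sphere_hess u (s *: w)) sphere_hessZ normrZ exprMn (ger0_norm s0).
    by rewrite clinZ !mulrA.
  - by rewrite /w tproj_sum// clin_sum.
  rewrite divr_ge0 ?form_ge0//=; last by rewrite mulr_ge0// ltW.
  rewrite ler_pdivrMr ?mulr_gt0// mul1r (le_trans (form_sqr_le bform _))//.
  by rewrite (le_trans _ sv4)// expr2 ler_piMl.
have sumD (eta : R) : \sum_(i < d.+1) eta = D * eta.
  by rewrite sumr_const card_ord mulr_natl.
have hess_le u w : `|u| <= K + 1 -> sphere_hess u w <= C3 * `|w| ^+ 2.
  move=> uK; have [d1N d2N] := bdN _ uK.
  rewrite /C3 mulrDl lerD//.
    by rewrite (le_trans (ler_norm _))// expr2 clin2_bound.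
  rewrite (le_trans (ler_norm _))// normrN normrM.
  rewrite (ger0_norm (form_ge0 bform _)) ler_pM ?form_ge0 ?form_sqr_le//.
  rewrite normrM normfV (gtr0_norm mu_gt0) ler_wpM2r ?invr_ge0 ?(ltW mu_gt0)//.
  by rewrite (le_trans (clin_bound _ d1N))// ler_wpM2l// ltW.
case: typ => [[v [v0 v1 vd]] | [e [e0 eE eneg]]].
  exists (fun=> v); split=> // u c eta s uS ur eta0 c1 [i ci] ce s01.
  have [] := main (fun=> v) (fun=> v0) u c eta s uS ur eta0 (fun=> v1) c1 ce s01.
  set w := tproj u _; set q := _ / (4 * mu); set l := dphi u (tproj u v) in ce *.
  move=> /andP[q0 q1] T _ wD dE.
  have lle : l <= - (3 * delta / 4).
    have [|_ + _] := close u0 u v u0K _ v0; first by move: ur; rewrite le_min => /andP[].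
    move=> h; have {h} : l - dphi u0 v <= delta / 4.
      apply: (le_trans (ler_norm _)); apply: (le_trans h).
      by rewrite ler_piMr// ltW.
    exact: steep_close.
  have cil : c i * l = l.
    have := ce i; rewrite /= => cil.
    have /orP[/eqP ->|/eqP c1'] : (c i == 1) || (c i == -1).
        by rewrite -eqr_norm2 ci normr1.
      by rewrite mul1r.
    by exfalso; move: cil; rewrite c1' mulN1r => cil; case/andP: eta0 => eta0 eta1; lra.
  have dle : dphi u w <= D * eta - 3 * delta / 4.
    have : - l <= D * eta - dphi u w.
      rewrite dE -sumD -sumrB (bigD1 i)//= -/l cil.
      apply: ler_wpDr; first by rewrite sumr_ge0// => j _; rewrite subr_ge0 ce.
      by rewrite lerDr; case/andP: eta0.
    exact: steep_sum.
  apply: (le_trans T); rewrite -!addrA lerD2l.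
  apply: (@steep_gain _ _ _ _ _ _ C4) => //.
  - by rewrite q0.
  - by rewrite mulr_ge0//; case/andP: eta0.
  - by move: s01; rewrite !le_min => /and3P[-> ->].
  - move: s01; rewrite !le_min => /andP[_ /and3P[_ _]].
    by rewrite ler_pdivlMr ?mulr_gt0 ?ltr_wpDl// => h; lra.
  - have uK : `|u| <= K + 1.
      rewrite -[u](subrK u0) (le_trans (ler_normD _ _))// addrC lerD//.
      by move: ur; rewrite le_min => /andP[].
    rewrite [X in _ + X]mulrCA -mulrDr ler_wpM2l ?exprn_ge0//; first by case/andP: s01.
    have ch := hess_le u w uK; have w2 : `|w| ^+ 2 <= 4 * D ^+ 2.
      by rewrite [leRHS](_ : _ = (2 * D) ^+ 2) ?ler_pXn2r ?nnegrE//; ring.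
    have C3d : 0 <= C3 / 2 + delta / 32 by lra.
    apply: (@le_trans _ _ ((C3 / 2 + delta / 32) * `|w| ^+ 2)); last first.
      by rewrite ler_wpM2l.
    by move: ch; move: (sphere_hess u w) (`|w| ^+ 2) => x y; lra.
exists e; split => [i|u c eta s uS ur eta0 c1 [i ci] ce s01].
  rewrite -(@ler_pXn2r _ 2) ?nnegrE// -hilb eE eqxx expr1n.
  by [].
have e1 j : `|e j| <= 1.
  by rewrite -(@ler_pXn2r _ 2) ?nnegrE// -hilb eE eqxx expr1n.
have [] := main e e0 u c eta s uS ur eta0 e1 c1 ce s01.
have yn := orthonormal_norm_sum hilb c eE.
have y0 := form_sum0 c e0; have yneg := eneg c.
set y := \sum_i c i *: e i in yn y0 yneg *.
set w := tproj u _; set q := _ / (4 * mu).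
move=> /andP[q0 q1] T wy _ dE.
apply: (le_trans T); rewrite -!addrA lerD2l addrA.
have y1 : 1 <= `|y| ^+ 2.
  rewrite yn (bigD1 i)//= -(@real_normK _ (c i)) ?num_real// ci expr1n lerDl.
  by rewrite sumr_ge0// => j _; rewrite sqr_ge0.
apply: (@saddle_gain _ _ _ _ _ _ (`|y| ^+ 2)) => //.
- by rewrite mulr_ge0//; case/andP: eta0.
- by rewrite dE -sumD ler_sum.
- by move: s01; rewrite !le_min => /and3P[-> ->].
- have [|_ _ h] := close u0 u y u0K _ y0.
    by move: ur; rewrite le_min => /andP[].
  by apply: (le_trans h); rewrite lerD2r.
- rewrite [leRHS](_ : _ = (2 * `|y|) ^+ 2); last by ring.
  by rewrite ler_pXn2r ?nnegrE ?mulr_ge0.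
Qed.

End local_descent.

(** * Separated cubes *)

Section clamp.
Context (R : realType).
Implicit Types y : R.

(** The truncation of [y] to [0, 1], written so that continuity is evident. *)
Definition clamp y : R := (1 + `|y| - `|1 - y|) / 2.

Lemma clamp_ge1 y : 1 <= y -> clamp y = 1.
Proof.
by move=> y1; rewrite /clamp ger0_norm ?ler0_norm; [field|lra|lra].
Qed.

Lemma clamp_le0 y : y <= 0 -> clamp y = 0.
Proof.
by move=> y0; rewrite /clamp ler0_norm// ger0_norm; [field|lra].
Qed.

Lemma clamp_itv y : 0 <= clamp y <= 1.
Proof.
have [y0|y0] := leP y 0; first by rewrite clamp_le0// lexx ler01.
have [y1|y1] := leP 1 y; first by rewrite clamp_ge1// lexx ler01.
by rewrite /clamp !ger0_norm; lra.
Qed.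

Lemma clamp_continuous : continuous clamp.
Proof.
move=> y; apply: cvgM; last exact: cvg_cst.
apply: cvgB; first by apply: cvgD; [exact: cvg_cst|exact: norm_continuous].
by apply: cvg_norm; apply: cvgB; [exact: cvg_cst|exact: cvg_id].
Qed.

End clamp.

Section separated_cubes.
Context (R : realType).

Lemma sin_int_pi (t : R) (z : int) : t = z%:~R -> sin (pi * t) = 0.
Proof.
move=> ->; have nat0 n : sin (pi * n%:R : R) = 0.
  elim: n => [|n IH]; first by rewrite mulr0 sin0.
  by rewrite -natr1 mulrDr mulr1 sinDpi IH oppr0.
case: z => n; first exact: nat0.
by rewrite NegzE rmorphN/= mulrN sinN nat0 oppr0.
Qed.

Lemma floor_locally_constant (t : R) : sin (pi * t) != 0 ->
  \forall s \near t, Num.floor s = Num.floor t.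
Proof.
move=> st; have /andP[t1 t2] := floor_itv t.
have {}t1 : (Num.floor t)%:~R < t.
  rewrite lt_neqAle t1 andbT; apply: contra st => /eqP e.
  by apply/eqP; apply: sin_int_pi; exact: esym e.
near=> s; apply: floor_def; apply/andP; split; near: s.
  by apply: filterS (lt_nbhsr t1) => s /ltW.
exact: lt_nbhsl t2.
Unshelve. all: by end_near. Qed.

(** The function [`|sin (pi * t)|] serves as a continuous substitute for the
distance of [t] to the integers.  If the shifted arguments [x] and [y] both had
small sines, so would [x - y], which is one of finitely many multiples of [pi]
by nonintegral fractions. *)
Lemma sin_shift_gap d : exists2 m : R, 0 < m &
  forall (i k : 'I_d.+1) (t : R), i != k ->
    m <= `|sin (pi * (t - i%:R / d.+1%:R))| \/
    m <= `|sin (pi * (t - k%:R / d.+1%:R))|.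
Proof.
pose D : R := d.+1%:R.
pose m := \big[Num.min/1]_(n < d.+1 | (0 < n)%N) sin (pi * (n%:R / D)).
have D0 : 0 < D by rewrite ltr0n.
have m0 : 0 < m.
  apply: lt_bigmin => // n n0; apply: sin_gt0_pi.
  rewrite mulr_gt0 ?pi_gt0 ?divr_gt0 ?ltr0n//= -[ltRHS]mulr1.
  by rewrite ltr_pM2l ?pi_gt0// ltr_pdivrMr// mul1r ltr_nat.
exists (m / 2); first by rewrite divr_gt0.
move=> i k t; wlog : i k / (i < k)%N => [H ik|ik _].
  have := ik; rewrite -val_eqE neq_ltn => /orP[] lt; first exact: H.
  by have [|h|h] := H k i lt; [rewrite eq_sym|right|left].
set x := pi * _; set y := pi * (t - k%:R / D).
have xy : sin (x - y) >= m.
  have kD : (k - i < d.+1)%N by rewrite (leq_ltn_trans (leq_subr _ _)).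
  have -> : x - y = pi * ((k - i)%:R / D).
    by rewrite /x /y natrB ?(ltnW ik)// -mulrBr; congr (_ * _); field; rewrite gt_eqF.
  by rewrite /m (bigmin_inf (Ordinal kD))//= subn_gt0.
have : m <= `|sin x| + `|sin y|.
  apply: (le_trans xy); rewrite sinB (le_trans (ler_norm _))//.
  rewrite (le_trans (ler_normB _ _))// !normrM lerD//.
    by rewrite ler_piMr// ler_norml cos_geN1 cos_le1.
  by rewrite ler_piMl// ler_norml cos_geN1 cos_le1.
have [?|h1] := leP (m / 2) `|sin x|; first by left.
have [?|h2] := leP (m / 2) `|sin y|; first by right.
by move=> h; exfalso; move: h h1 h2; move: `|sin x| `|sin y| => a b; lra.
Qed.

(** The label of a point for the [i]-th grid is the cube containing it, and
[chi i] vanishes exactly on the walls of that grid.  If [chi i x < 1] for all the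
[d + 1] grids, then two of them have a wall near [x] in the same coordinate
among [d], which [sin_shift_gap] excludes. *)
Lemma separated_cubes d (h : R) : 0 < h ->
  exists (chi : 'I_d.+1 -> 'rV[R]_d -> R) (lab : 'I_d.+1 -> 'rV[R]_d -> {ffun 'I_d -> int}),
  [/\ forall i x, 0 <= chi i x <= 1,
      forall x, exists i, chi i x = 1,
      forall i, continuous (chi i),
      forall i x, chi i x != 0 -> \forall y \near x, lab i y = lab i x &
      forall i x y, lab i x = lab i y -> forall j, `|x 0 j - y 0 j| <= h].
Proof.
move=> h0; have [m m0 gap] := sin_shift_gap d.
pose t (i : 'I_d.+1) (j : 'I_d) (x : 'rV[R]_d) : R := x 0 j / h - i%:R / d.+1%:R.
pose g i j x := clamp (`|sin (pi * t i j x)| / m).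
have tc i j : continuous (t i j).
  move=> x; rewrite /continuous_at /t.
  apply: (@cvgB _ _ _ (nbhs x) (nbhs_filter x)); last exact: cvg_cst.
  apply: (@cvgM _ _ (nbhs x) (nbhs_filter x)); last exact: cvg_cst.
  exact: coord_continuous.
have gc i j : continuous (g i j).
  move=> x; apply: (continuous_comp (g := fun r => clamp (`|sin (pi * r)| / m))).
    exact: tc.
  apply: (continuous_comp (g := clamp (R := R)) (f := fun r => `|sin (pi * r)| / m));
    last exact: clamp_continuous.
  apply: cvgM; last exact: cvg_cst.
  apply: cvg_norm.
  apply: (continuous_comp (g := sin) (f := fun r => pi * r)); last exact: continuous_sin.
  by apply: cvgM; [exact: cvg_cst|exact: cvg_id].
exists (fun i x => \prod_j g i j x), (fun i x => [ffun j => Num.floor (t i j x)]).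
split.
- move=> i x; elim/big_ind : _ => [|u v /andP[u0 u1] /andP[v0 v1]|j _].
  + by rewrite ler01 lexx.
  + by rewrite mulr_ge0//= mulr_ile1.
  + exact: clamp_itv.
- move=> x; apply: contrapT => /forallNP bad.
  have {}bad i : exists j, `|sin (pi * t i j x)| < m.
    apply: contrapT => /forallNP ok; apply: (bad i); apply: big1 => j _.
    rewrite /g clamp_ge1// ler_pdivlMr// mul1r leNgt.
    exact/negP/ok.
  have [J badJ] := choice bad.
  have : ~~ injectiveb J.
    apply/negP => /injectiveP /leq_card; rewrite !card_ord ltnn //.
  move/injectivePn => [i [k ik Jik]].
  have [|] := gap i k (x 0 (J i) / h) ik.
    by rewrite leNgt; have := badJ i; rewrite /t => ->.
  by rewrite leNgt Jik; have := badJ k; rewrite /t => ->.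
- by move=> i; apply: continuous_big => [|j _]; [exact: mul_continuous|exact: gc].
- move=> i x /prodf_neq0 chi0.
  have flo j : \forall y \near x, Num.floor (t i j y) = Num.floor (t i j x).
    apply: (tc i j x [set s | Num.floor s = Num.floor (t i j x)]).
    apply: floor_locally_constant.
    apply: contra (chi0 j isT) => /eqP s0.
    by rewrite /g s0 normr0 mul0r clamp_le0.
  have : \forall y \near x, forall j, Num.floor (t i j y) = Num.floor (t i j x).
    exact: (@filter_forall _ _ _ _ (nbhs_filter x) flo).
  by apply: filterS => y H; apply/ffunP => j; rewrite !ffunE.
- move=> i x y /ffunP xy j; have := xy j; rewrite !ffunE => e.
  have /andP[a1 a2] := floor_itv (t i j x).
  have /andP[b1 b2] := floor_itv (t i j y).
  rewrite e intrD in a1 a2; rewrite intrD in b2.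
  have -> : x 0 j - y 0 j = h * (t i j x - t i j y).
    by rewrite /t; field; rewrite !gt_eqF// ltr0n.
  rewrite normrM (gtr0_norm h0) ler_piMr ?(ltW h0)//.
  move: a1 a2 b1 b2; move: (t i j x) (t i j y) (_%:~R) => u v z.
  by rewrite ler_norml; lra.
Qed.

End separated_cubes.

(** * Uniform continuity *)

Section compact_domain.
Context (R : realType) (d : nat) (W : normedModType R) (D : set 'rV[R]_d).
Hypothesis cD : compact D.

(** Stated coordinatewise, as distances of points in a common cube are. *)
Lemma compact_unif_cont (f : 'rV[R]_d -> W) (eps : R) :
  {within D, continuous f} -> 0 < eps ->
  exists2 h, 0 < h & forall x y, D x -> D y ->
    (forall j, `|x 0 j - y 0 j| <= h) -> `|f x - f y| <= eps.
Proof.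
move=> /subspace_continuousP fc eps0.
have /compact_near_coveringP/near_covering_withinP cov := cD.
pose P (h : R) (x : 'rV[R]_d) := forall y : 'rV[R]_d, D y -> (forall j, `|x 0 j - y 0 j| <= h) ->
  `|f x - f y| <= eps.
have : \forall h \near (0 : R)^'+, D `<=` P h.
  apply: (cov R (0 : R)^'+ P) => x Dx.
  have eps2 : 0 < eps / 2 by rewrite divr_gt0.
  have /cvgrPdist_le/(_ _ eps2) := fc x Dx.
  rewrite near_withinE => /nbhs_ballP[del /= del0 xdel].
  exists (ball x (del / 2), [set h | h < del / 2]).
    split; first by apply: nbhsx_ballx; rewrite divr_gt0.
    by apply: nbhs_right_lt; rewrite divr_gt0.
  move=> [x' h] /= [[_ xx'] hdel] Dx' y Dy x'y.
  have e1 : `|f x - f x'| <= eps / 2.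
    apply: xdel => //; split=> // i j.
    apply: (@le_ball _ _ _ (del / 2)) (xx' i j).
    by rewrite ler_pdivrMr// ler_peMr ?ltW// ltr1n.
  have e2 : `|f x - f y| <= eps / 2.
    apply: xdel => //; split=> // i j; rewrite [del]splitr.
    apply: ball_triangle (xx' i j) _.
    by rewrite ord1 /ball/= (le_lt_trans (x'y j)).
  rewrite [eps]splitr (le_trans (ler_distD (f x) _ _))// lerD//.
  by rewrite distrC.
move=> DP.
have [h [h0 hP]] := filter_ex (filterI (nbhs_right_gt (0 : R)) DP).
by exists h => // x y Dx Dy; exact: hP.
Qed.

End compact_domain.

(** A label which may jump where its amplitude [a] vanishes still gives a
continuous vector field. *)
Lemma scaled_label_cvg (R : realType) (T L : Type) (F : set_system T)
    (FF : Filter F) (W : normedModType R) (a : T -> R) (l : T -> L) (w : L -> W)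
    (a0 : R) (l0 : L) :
  a @ F --> a0 -> (forall q, `|w q| <= 1) ->
  (a0 != 0 -> \forall y \near F, l y = l0) ->
  (fun y => a y *: w (l y)) @ F --> a0 *: w l0.
Proof.
move=> aa0 w1; have [a00 _|a0n0 /(_ isT) ll0] := eqVneq a0 0.
  rewrite a00 in aa0 *; rewrite scale0r; apply/cvgrPdist_le => e e0.
  move/cvgrPdist_le : aa0 => /(_ _ e0); apply: filterS => y.
  rewrite !sub0r !normrN normrZ => h; apply: le_trans h.
  by rewrite ler_piMr.
have : (fun y => a y *: w l0) @ F --> a0 *: w l0 by apply: cvgZr_tmp.
apply: cvg_trans; apply: near_eq_cvg.
by apply: filterS ll0 => y ->.
Qed.

Section gradient_cont.
Context (R : realType) (E : completeNormedModType R) (b : E -> E -> R).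
Hypothesis bform : contractive_form b.
Variable mu : R.
Hypothesis mu_gt0 : 0 < mu.
Context (phi : E -> R) (alpha : R).
Hypothesis alpha_gt0 : 0 < alpha.
Hypothesis phiH : holder_on_bounded_sets alpha phi.

Local Notation dphi := (frechet phi).
Local Notation tproj := (tproj b mu).

Lemma tproj_gradE (f : 'L(E, R)) u e : f (tproj u e) = f e - b u e / mu * f u.
Proof. by rewrite clinB clinZ. Qed.

Lemma tproj_grad_diff (f g : 'L(E, R)) u w e :
  f (tproj u e) - g (tproj w e) =
  (f - g) e - (b (u - w) e * f u + b w e * (f (u - w) + (f - g) w)) / mu.
Proof.
rewrite !tproj_gradE (formBl bform) clinB !clinBl; field.
by rewrite gt_eqF.
Qed.

(** Uniformity in [e] is what matters: the size of the fine cubes has to be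
chosen before it is known which vector is used on which cube. *)
Lemma grad_unif_cont K eta : 0 <= K -> 0 < eta -> exists2 r, 0 < r &
  forall u w e, `|u| <= K -> `|w| <= K -> `|u - w| <= r -> `|e| <= 1 ->
    `|dphi u (tproj u e) - dphi w (tproj w e)| <= eta.
Proof.
move=> K0 eta0.
have [N N0 bdN] := holder_bounded alpha_gt0 phiH K.
pose C1 := 2 * N * K / mu; pose C2 := 1 + K ^+ 2 / mu.
have C10 : 0 <= C1 by rewrite !(mulr_ge0, invr_ge0, (ltW N0), (ltW mu_gt0)).
have C20 : 0 < C2 by rewrite ltr_pwDl// divr_ge0 ?exprn_ge0// ltW.
pose tau := eta / (2 * C2).
have tau0 : 0 < tau by rewrite divr_gt0// mulr_gt0.
have [r r0 unif] := holder_unif_cont alpha_gt0 phiH K tau0.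
exists (Num.min r (eta / (2 * (C1 + 1)))).
  by rewrite lt_min r0 divr_gt0// mulr_gt0// ltr_wpDl.
move=> u w e uK wK; rewrite le_min => /andP[ur ueta] e1.
have [t1 _] := unif u w uK wK ur.
have [d1N _] := bdN _ uK.
set x := `|u - w| in ur ueta; have x0 : 0 <= x by exact: normr_ge0.
rewrite (tproj_grad_diff (dphi u) (dphi w) u w e).
have f1 : `|(dphi u - dphi w) e| <= tau.
  by rewrite (le_trans (clin_bound _ t1))// ler_piMr// ltW.
have f2 : `|b (u - w) e * dphi u u| <= x * (N * K).
  rewrite normrM ler_pM//.
    by rewrite (le_trans (form_le bform _ _))// ler_piMr.
  by rewrite (le_trans (clin_bound _ d1N))// ler_wpM2l// ltW.
have f3 : `|b w e * (dphi u (u - w) + (dphi u - dphi w) w)| <= K * (N * x + tau * K).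
  rewrite normrM ler_pM//.
    by rewrite (le_trans (form_le bform _ _))// (le_trans _ wK)// ler_piMr.
  rewrite (le_trans (ler_normD _ _))// lerD//; first exact: clin_bound.
  by rewrite (le_trans (clin_bound _ t1))// ler_wpM2l// ltW.
rewrite (le_trans (ler_normB _ _))// normrM normfV (gtr0_norm mu_gt0).
apply: (@le_trans _ _ (tau + (x * (N * K) + K * (N * x + tau * K)) / mu)).
  rewrite lerD// ler_wpM2r ?invr_ge0 ?(ltW mu_gt0)//.
  by rewrite (le_trans (ler_normD _ _))// lerD.
rewrite [leLHS](_ : _ = tau * C2 + x * C1); last first.
  by rewrite /C1 /C2; field; rewrite gt_eqF.
rewrite [leRHS]splitr lerD//.
  by rewrite /tau invfM !mulrA divfK ?gt_eqF.
move: ueta; rewrite ler_pdivlMr ?mulr_gt0 ?ltr_wpDl// => ueta.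
rewrite ler_pdivlMr//; apply: le_trans ueta.
by rewrite -mulrA ler_wpM2l// mulrC ler_wpM2l// lerDl.
Qed.

End gradient_cont.

(** * Deformations *)

(** The sign opposite to [g2] makes any nearby number [g1] almost nonpositive. *)
Lemma sign_choice (R : realType) (k g1 g2 eta : R) :
  0 <= k <= 1 -> 0 <= eta -> `|g1 - g2| <= eta ->
  k * (if 0 <= g2 then -1 else 1) * g1 <= eta.
Proof.
move=> /andP[k0 k1] eta0; rewrite ler_norml => /andP[h1 h2].
by case: ifP => g2s; [|move/negbT : g2s; rewrite -ltNge => g2s]; nra.
Qed.

Section deformation.
Context (R : realType) (E : completeNormedModType R) (b : E -> E -> R).
Hypothesis bform : contractive_form b.
Variable mu : R.
Hypothesis mu_gt0 : 0 < mu.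
Context (phi : E -> R) (alpha : R).
Hypothesis alpha_gt0 : 0 < alpha.
Hypothesis phiH : holder_on_bounded_sets alpha phi.
Variables (d : nat) (D : set 'rV[R]_d).
Hypothesis cD : compact D.

Local Notation dphi := (frechet phi).
Local Notation tproj := (tproj b mu).
Local Notation slide := (slide b mu).
Local Notation Dim := (d.+1%:R : R).

(** One push, on the coarse cubes [lab] with amplitude [lam * chi].  Each coarse
cube comes with a descent point [ctr] and its vectors [e], and is subdivided by
[d + 1] fine grids; the [i]-th grid carries the vector [e i], with on each fine
cube the sign [sg] opposite to the slope at a chosen point [y] of the cube.
Cubes so fine that slopes vary by at most [eta] make every signed slope at most
[eta], and at each point some fine amplitude equals one, which are the two
conditions of [descent_point]. *)
Lemma push_along_cubes (L : Type) (f : 'rV[R]_d -> E) (lam chi : 'rV[R]_d -> R)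
    (lab : 'rV[R]_d -> L) (ctr : L -> E) (r s0 kappa eta0 eta s K : R) :
  {within D, continuous f} -> (forall x, D x -> b (f x) (f x) = mu) ->
  {within D, continuous lam} -> (forall x, 0 <= lam x <= 1) ->
  continuous chi -> (forall x, 0 <= chi x <= 1) ->
  (forall x, chi x != 0 -> \forall y \near x, lab y = lab x) ->
  (forall x, D x -> lam x * chi x != 0 ->
    [/\ descent_point b mu phi d r s0 kappa eta0 (ctr (lab x)),
        `|f x - ctr (lab x)| <= r & `|f x| <= K]) ->
  0 < kappa -> 0 <= K -> 0 < eta <= eta0 -> 0 <= s <= s0 ->
  s * ((1 + K ^+ 2 / mu) * Dim) * K <= 2 * mu ->
  exists f' : 'rV[R]_d -> E, [/\ {within D, continuous f'},
    forall x, D x -> b (f' x) (f' x) = mu,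
    forall x, D x -> lam x = 0 -> f' x = f x,
    forall x, D x -> `|f' x - f x| <= 2 * (s * ((1 + K ^+ 2 / mu) * Dim)) &
    forall x, D x -> phi (f' x) <= phi (f x) + Dim * eta /\
      (lam x = 1 -> chi x = 1 ->
        phi (f' x) <= phi (f x) + Dim * eta - kappa * s ^+ 2)].
Proof.
move=> fc fS lamc lam01 chic chi01 labc good kappa0 K0 /andP[eta_gt0 eta_le] s01 sK.
have s_ge0 : 0 <= s by case/andP: s01.
have [rho rho0 gradc] := grad_unif_cont bform mu_gt0 alpha_gt0 phiH K0 eta_gt0.
have [h h0 fh] := compact_unif_cont cD fc rho0.
have [chi' [lab' [chi'01 chi'1 chi'c lab'c lab'h]]] := separated_cubes d h0.
pose desc q (e : 'I_d.+1 -> E) := (forall i, `|e i| <= 1) /\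
  (descent_point b mu phi d r s0 kappa eta0 (ctr q) ->
   forall u c eta s, b u u = mu -> `|u - ctr q| <= r -> 0 <= eta <= eta0 ->
    (forall i, `|c i| <= 1) -> (exists i, `|c i| = 1) ->
    (forall i, c i * dphi u (tproj u (e i)) <= eta) -> 0 <= s <= s0 ->
    phi (slide u (s *: tproj u (\sum_i c i *: e i)))
      <= phi u + Dim * eta - kappa * s ^+ 2).
have [q|e eP] := @choice _ _ desc.
  have [[e [e1 eD]]|nd] := pselect (descent_point b mu phi d r s0 kappa eta0 (ctr q)).
    by exists e; split.
  by exists (fun=> 0); split => [i|//]; rewrite normr0.
pose y q i (p : {ffun 'I_d -> int}) : 'rV[R]_d :=
  get [set x | [/\ D x, lam x * chi x != 0, lab x = q & lab' i x = p]].
pose sg q i p : R := if 0 <= dphi (f (y q i p)) (tproj (f (y q i p)) (e q i)) then -1 else 1.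
have sg1 q i p : `|sg q i p| = 1.
  by rewrite /sg; case: ifP => _; rewrite ?normrN normr1.
pose a i x := lam x * chi x * chi' i x.
pose w i (qp : L * {ffun 'I_d -> int}) := sg qp.1 i qp.2 *: e qp.1 i.
pose V x := \sum_i a i x *: w i (lab x, lab' i x).
pose c x i := chi' i x * sg (lab x) i (lab' i x).
have VE x : V x = (lam x * chi x) *: \sum_i c x i *: e (lab x) i.
  rewrite scaler_sumr; apply: eq_bigr => i _.
  by rewrite /a /w /c/= !scalerA !mulrA.
pose f' x := slide (f x) (tproj (f x) (s *: V x)).
have Vc x : D x -> V @ within D (nbhs x) --> V x.
  move=> Dx; have FF : Filter (within D (nbhs x)).
    by apply: within_filter; exact: nbhs_filter.
  rewrite /V; apply: (@cvg_big E _ +%R 0 predT _ _ (within D (nbhs x)) (index_enum _)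
    (fun i y => a i y *: w i (lab y, lab' i y)) (fun i => a i x *: w i (lab x, lab' i x)) FF).
    exact: add_continuous.
  move=> i _; apply: (@scaled_label_cvg _ _ _ _ _ _ (a i)
      (fun x => (lab x, lab' i x)) (w i)).
  - move/subspace_continuousP : lamc => /(_ x Dx) lamx.
    apply: cvgM; last by apply: cvg_within_filter; exact: chi'c.
    by apply: cvgM => //; apply: cvg_within_filter; exact: chic.
  - by move=> [q p]; rewrite normrZ sg1 mul1r; exact: (eP q).1.
  - rewrite /a !mulf_eq0 !negb_or => /andP[/andP[_ cx] c'x].
    have n1 := labc x cx; have n2 := lab'c i x c'x.
    rewrite near_withinE; apply: filterS2 n1 n2 => z -> -> //.
have f'c : {within D, continuous f'}.
  apply/subspace_continuousP => x Dx.
  apply: slide_cvg => //; first by move/subspace_continuousP : fc; exact.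
  exact: (@cvgZl_tmp _ _ _ _ (within_filter _ (nbhs_filter x)) _ _ _ (Vc x Dx)).
have a01 x : 0 <= lam x * chi x <= 1.
  case/andP: (lam01 x) => l0 l1; case/andP: (chi01 x) => k0 k1.
  by rewrite mulr_ge0//= mulr_ile1.
have c1 x i : `|c x i| <= 1.
  rewrite /c normrM sg1 mulr1; have /andP[? ?] := chi'01 i x.
  by rewrite ger0_norm.
have f'E x : f' x = slide (f x) ((s * (lam x * chi x)) *:
    tproj (f x) (\sum_i c x i *: e (lab x) i)).
  by rewrite /f' VE scalerA tprojZ.
have f'0 x : lam x * chi x = 0 -> f' x = f x.
  by move=> a0; rewrite f'E a0 mulr0 scale0r slide0.
exists f'; split => //.
- move=> x Dx; apply: slide_sphere => //; first exact: fS.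
  by apply: tproj_tangent => //; exact: fS.
- by move=> x Dx l0; rewrite f'0// l0 mul0r.
- move=> x Dx; have [a0|an0] := eqVneq (lam x * chi x) 0.
    rewrite f'0// subrr normr0 !mulr_ge0// addr_ge0// divr_ge0 ?exprn_ge0//.
    exact: ltW.
  have [_ _ fK] := good x Dx an0.
  have Ve : `|\sum_i c x i *: e (lab x) i| <= Dim.
    rewrite (le_trans (ler_norm_sum _ _ _))//.
    rewrite [leRHS](_ : _ = \sum_(i < d.+1) (1 : R)); last first.
      by rewrite sumr_const card_ord.
    by apply: ler_sum => i _; rewrite normrZ mulr_ile1//; exact: (eP _).1.
  have tle : `|(s * (lam x * chi x)) *: tproj (f x) (\sum_i c x i *: e (lab x) i)|
      <= s * ((1 + K ^+ 2 / mu) * Dim).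
    rewrite normrZ normrM (ger0_norm s_ge0) -mulrA ler_wpM2l//.
    have /andP[A0 A1] := a01 x.
    rewrite (ger0_norm A0) (@le_trans _ _ `|tproj (f x) (\sum_i c x i *: e (lab x) i)|)//.
      by rewrite ler_piMl.
    rewrite (le_trans (tproj_le bform mu_gt0 _ fK))// ler_wpM2l//.
    by rewrite addr_ge0// divr_ge0 ?exprn_ge0// ltW.
  rewrite f'E (le_trans (slide_dist bform mu_gt0 fK _))//.
    by apply: le_trans sK; rewrite ler_wpM2r.
  by rewrite ler_wpM2l.
move=> x Dx; have [a0|an0] := eqVneq (lam x * chi x) 0.
  rewrite f'0//; split; first by rewrite lerDl mulr_ge0// ltW.
  by move=> l1 k1; move/eqP: a0; rewrite l1 k1 mulr1 oner_eq0.
have [dp fr fK] := good x Dx an0.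
have gain : phi (f' x) <= phi (f x) + Dim * eta
    - kappa * (s * (lam x * chi x)) ^+ 2.
  rewrite f'E; apply: ((eP (lab x)).2 dp) => //; first exact: fS.
  - by rewrite (ltW eta_gt0).
  - have [i ci] := chi'1 x; exists i.
    by rewrite /c normrM sg1 mulr1 ci normr1.
  - move=> i; rewrite /c; set p := lab' i x.
    have := getPex (P := [set z | [/\ D z, lam z * chi z != 0, lab z = lab x
        & lab' i z = p]]) (ex_intro _ x (And4 Dx an0 erefl erefl)).
    rewrite -/(y (lab x) i p); set z := y (lab x) i p => -[Dz az labz lab'z].
    have [_ _ fzK] := good z Dz az.
    have close : `|f x - f z| <= rho.
      by apply: fh => // j; apply: (lab'h i); rewrite lab'z.
    rewrite /sg -/z; apply: sign_choice; [exact: chi'01|exact: ltW|].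
    exact: gradc fK fzK close ((eP (lab x)).1 i).
  - case/andP: s01 => _ ss0; case/andP: (a01 x) => A0 A1.
    by rewrite mulr_ge0//= (le_trans _ ss0)// ler_piMr.
split => [|l1 k1]; last by move: gain; rewrite l1 k1 !mulr1.
by rewrite (le_trans gain)// gerBl mulr_ge0 ?sqr_ge0// ltW.
Qed.

End deformation.

Section deform_below.
Context (R : realType) (E : completeNormedModType R) (b : E -> E -> R).
Hypothesis bform : contractive_form b.
Variable mu : R.
Hypothesis mu_gt0 : 0 < mu.
Context (ip : {dot E for (@idfun R)}).
Hypothesis hilb : hilbert ip.
Context (phi : E -> R) (alpha : R).
Hypothesis alpha_gt0 : 0 < alpha.
Hypothesis phiC2 : C2 phi.
Hypothesis phiH : holder_on_bounded_sets alpha phi.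
Variable d : nat.

Local Notation Dim := (d.+1%:R : R).

(** The [d + 1] coarse families are treated in turn, the fine grids of each push
being adapted to the map obtained so far.  The time [s] of a push is such that
the total displacement keeps all the maps in the balls of radius [r] where the
descent directions are valid; it does not depend on [f] nor on [eps], and the
gain [kappa * s ^+ 2] exceeds [eps] by far.  The losses [Dim * eta] of all the
pushes together amount to at most [eps / 4]. *)
Lemma deform_below K delta : 0 <= K -> 0 < delta -> exists2 eps1, 0 < eps1 &
  forall (D : set 'rV[R]_d) (f : 'rV[R]_d -> E) (c eps : R),
    compact D -> {within D, continuous f} ->
    (forall x, D x -> b (f x) (f x) = mu) -> 0 < eps <= eps1 ->
    (forall x, D x -> phi (f x) <= c + eps) ->
    (forall x, D x -> c - eps <= phi (f x) ->
      `|f x| <= K /\ (steep b phi delta (f x) \/ saddle b mu ip phi d delta (f x))) ->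
  exists f' : 'rV[R]_d -> E, [/\ {within D, continuous f'},
    forall x, D x -> b (f' x) (f' x) = mu,
    forall x, D x -> phi (f x) <= c - eps -> f' x = f x &
    forall x, D x -> phi (f' x) <= c - eps / 4].
Proof.
move=> K0 delta0.
have [r [s0 [kappa [eta0 [r0 /andP[s00 s01] kappa0 eta00 dp]]]]] :=
  descent_points bform mu_gt0 hilb alpha_gt0 phiC2 phiH d K0 delta0.
have Dim0 : 0 < Dim by rewrite ltr0n.
pose K1 := K + r; have K10 : 0 < K1 by rewrite ltr_wpDl.
pose A := (1 + K1 ^+ 2 / mu) * Dim.
have A0 : 0 < A by rewrite mulr_gt0// ltr_pwDl// divr_ge0 ?exprn_ge0 ?ltW.
have AK0 : 0 < A * K1 by apply: mulr_gt0.
have AD0 : 0 < 4 * A * Dim by apply: mulr_gt0 => //; apply: mulr_gt0.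
pose s := Num.min s0 (Num.min (2 * mu / (A * K1)) (r / (4 * A * Dim))).
have s_gt0 : 0 < s.
  by rewrite !lt_min s00 !divr_gt0// mulr_gt0.
have [ss0 [sK sr]] : s <= s0 /\ s * A * K1 <= 2 * mu /\ Dim * (2 * (s * A)) <= r / 2.
  have : s <= s by [].
  rewrite {2}/s !le_min => /and3P[h1 h2 h3]; split=> //; split.
    by move: h2; rewrite ler_pdivlMr// mulrA.
  move: h3; rewrite ler_pdivlMr// => h3.
  rewrite [leLHS](_ : _ = s * (4 * A * Dim) / 2); last by field.
  by rewrite ler_wpM2r.
exists (kappa * s ^+ 2 / 4).
  by rewrite divr_gt0// mulr_gt0// exprn_gt0.
move=> D f c eps cD fc fS /andP[eps0 eps1] ftop good.
have [h h0 fh] := compact_unif_cont cD fc (divr_gt0 r0 (ltr0n R 2)).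
have [chi [lab [chi01 chi1 chic labc labh]]] := separated_cubes d h0.
(* [lam] is 0 below level [c - eps] and 1 above level [c - eps / 2]. *)
pose lam x := clamp ((phi (f x) - (c - eps)) * (2 / eps)).
have lamc : {within D, continuous lam}.
  have phic : continuous phi.
    by move=> u; apply: differentiable_continuous; exact: phiC2.1.1.
  apply/subspace_continuousP => x Dx.
  have FF : Filter (within D (nbhs x)) by apply: within_filter; exact: nbhs_filter.
  apply: (@continuous_cvg _ _ _ _ FF _ (fun u => clamp ((phi u - (c - eps)) * (2 / eps)))).
    apply: (continuous_comp (g := clamp (R := R))
      (f := fun u => (phi u - (c - eps)) * (2 / eps))); last exact: clamp_continuous.
    by apply: cvgM; [apply: cvgB; [exact: phic|exact: cvg_cst]|exact: cvg_cst].
  by move/subspace_continuousP : fc; exact.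
have lam_low x : phi (f x) <= c - eps -> lam x = 0.
  by move=> h1; rewrite /lam clamp_le0// mulr_le0_ge0 ?divr_ge0 ?subr_le0// ltW.
have lam_high x : c - eps / 2 <= phi (f x) -> lam x = 1.
  move=> h1; rewrite /lam clamp_ge1// mulrA ler_pdivlMr// mul1r.
  lra.
have lam_n0 x : D x -> lam x != 0 -> `|f x| <= K /\
    (steep b phi delta (f x) \/ saddle b mu ip phi d delta (f x)).
  move=> Dx lx; apply: good => //; rewrite leNgt; apply: contra lx => /ltW lx.
  by rewrite lam_low.
pose eta := Num.min eta0 (eps / (4 * Dim ^+ 2)).
have eta_gt0 : 0 < eta by rewrite lt_min eta00 divr_gt0// mulr_gt0// exprn_gt0.
have eta_le0 : eta <= eta0 by rewrite ge_min lexx.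
have eta_eps : Dim * (Dim * eta) <= eps / 4.
  have : eta <= eps / (4 * Dim ^+ 2) by rewrite ge_min lexx orbT.
  rewrite ler_pdivlMr ?mulr_gt0 ?exprn_gt0// => h1.
  rewrite [leLHS](_ : _ = eta * (4 * Dim ^+ 2) / 4); last by field.
  by rewrite ler_wpM2r.
have step k : (k <= d.+1)%N -> exists g : 'rV[R]_d -> E, [/\ {within D, continuous g},
    forall x, D x -> b (g x) (g x) = mu,
    forall x, D x -> lam x = 0 -> g x = f x,
    forall x, D x -> `|g x - f x| <= k%:R * (2 * (s * A)) &
    forall x, D x -> phi (g x) <= phi (f x) + k%:R * (Dim * eta) /\
      forall J : 'I_d.+1, (J < k)%N -> lam x = 1 -> chi J x = 1 ->
        phi (g x) <= phi (f x) + k%:R * (Dim * eta) - kappa * s ^+ 2].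
  elim: k => [_|k IH kd].
    exists f; split=> // x Dx; first by rewrite subrr normr0 mul0r.
    by split=> //; rewrite mul0r addr0.
  have [g [gc gS g0 gf gphi]] := IH (ltnW kd).
  pose J := Ordinal kd.
  pose ctr q := f (get [set x | [/\ D x, lam x != 0 & lab J x = q]]).
  have [g' [g'c g'S g'0 g'g g'phi]] : exists g' : 'rV[R]_d -> E,
    [/\ {within D, continuous g'},
    forall x, D x -> b (g' x) (g' x) = mu,
    forall x, D x -> lam x = 0 -> g' x = g x,
    forall x, D x -> `|g' x - g x| <= 2 * (s * A) &
    forall x, D x -> phi (g' x) <= phi (g x) + Dim * eta /\
      (lam x = 1 -> chi J x = 1 ->
        phi (g' x) <= phi (g x) + Dim * eta - kappa * s ^+ 2)].
    apply: (@push_along_cubes _ _ _ bform _ mu_gt0 _ _ alpha_gt0 phiH _ _ cD _ g lam (chi J)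
      (lab J) ctr r s0 kappa eta0 eta s K1) => //; rewrite ?(ltW K10) ?(ltW s_gt0) ?eta_gt0//.
    - by move=> x; exact: clamp_itv.
    - exact: labc.
    move=> x Dx; rewrite mulf_eq0 negb_or => /andP[lx cx].
    have := getPex (P := [set z | [/\ D z, lam z != 0 & lab J z = lab J x]])
      (ex_intro _ x (And3 Dx lx erefl)).
    rewrite /ctr; set z := get _ => -[Dz lz labz].
    have [zK zd] := lam_n0 z Dz lz; have [xK _] := lam_n0 x Dx lx.
    have gfr : `|g x - f x| <= r / 2.
      apply: (le_trans (gf x Dx)); apply: le_trans sr.
      have sA : 0 <= 2 * (s * A) by apply: ltW; apply: mulr_gt0 => //; apply: mulr_gt0.
      by rewrite ler_wpM2r// ler_nat ltnW.
    split.
    - by apply: dp => //; exact: fS.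
    - rewrite [r]splitr (le_trans (ler_distD (f x) _ _))// lerD//.
      by apply: fh => // j; apply: (labh J); rewrite labz.
    - rewrite -[g x](subrK (f x)) (le_trans (ler_normD _ _))// addrC lerD//.
      by rewrite (le_trans gfr)// ler_pdivrMr// ler_peMr ?ltW// ltr1n.
  exists g'; split=> //.
  - by move=> x Dx lx; rewrite g'0// g0.
  - move=> x Dx; rewrite (le_trans (ler_distD (g x) _ _))//.
    rewrite -natr1 mulrDl mul1r [leRHS]addrC lerD//; [exact: g'g|exact: gf].
  move=> x Dx; have [p1 p2] := gphi x Dx; have [q1 q2] := g'phi x Dx.
  have e1 : k.+1%:R * (Dim * eta) = k%:R * (Dim * eta) + Dim * eta.
    by rewrite -natr1 mulrDl mul1r.
  rewrite e1; split; first by rewrite (le_trans q1)// addrA lerD2r.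
  move=> J'; rewrite ltnS leq_eqVlt => /predU1P[J'k|J'k] lx cx.
    have J'J : J' = J by exact: val_inj.
    rewrite J'J in cx; rewrite (le_trans (q2 lx cx))//.
    by rewrite lerD2r addrA lerD2r.
  rewrite (le_trans q1)// addrA [leRHS]addrAC lerD2r.
   exact: p2 J'k lx cx.
have [g [gc gS g0 gf gphi]] := step d.+1 (leqnn _).
exists g; split=> //.
  by move=> x Dx h1; apply: g0 => //; exact: lam_low.
move=> x Dx; have [p1 p2] := gphi x Dx.
have [lx|lx] := leP (c - eps / 2) (phi (f x)); last first.
  move: p1 lx eta_eps; move: (phi (g x)) (phi (f x)) (_ * (_ * eta)) => u v w.
  by move=> h1 h2 h3; lra.
have [J chiJ] := chi1 x.
have := p2 J (ltn_ord J) (lam_high x lx) chiJ.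
have := ftop x Dx.
lra.
Qed.

End deform_below.

(** * Slopes of monotone functions *)

Section monotone_slopes.
Context (R : realType).
Local Notation leb := (@lebesgue_measure R).

Section cells.
Variables (p q : R) (c : R -> R) (M : R).
Hypothesis pq : p < q.
Hypothesis c_noninc : forall x y, p <= x -> x <= y -> y <= q -> c y <= c x.
Hypothesis M0 : 0 < M.

Let h n : R := (q - p) / n.+1%:R.
Let node n j : R := p + j%:R * h n.

(** The first cell is counted as steep because it has no left neighbour.  For
the others the drop of [c] is measured over the cell and its two neighbours,
so that a point of a cell which is not steep has a small slope to the left
neighbour's first node, at distance between [h n] and [2 * h n]. *)
Definition steep_cell n j := (j == 0)%N || (M * h n < c (node n j.-1) - c (node n j.+1)).

Let cell n j : set R :=
  if steep_cell n j then [set` `[node n j, node n j.+1[%R] else set0.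

Definition steep_cells n : set R := \big[setU/set0]_(j < n.+1) cell n j.

Let measurable_cell n j : measurable (cell n j).
Proof. by rewrite /cell; case: ifP => _; [exact: measurable_itv|]. Qed.

Let h_gt0 n : 0 < h n.
Proof. by rewrite divr_gt0 ?subr_gt0// ltr0n. Qed.

Let node_le n i j : (i <= j)%N -> node n i <= node n j.
Proof. by move=> ij; rewrite lerD2l ler_wpM2r ?ler_nat// ltW. Qed.

Let node0 n : node n 0 = p. Proof. by rewrite /node mul0r addr0. Qed.

Let nodeN n : node n n.+1 = q.
Proof. by rewrite /node /h mulrC divfK ?pnatr_eq0// addrC subrK. Qed.

Let nodeS n j : node n j.+1 - node n j = h n.
Proof. by rewrite /node -natr1 mulrDl mul1r; ring. Qed.

Let c_node_le n i j : (i <= j)%N -> (j <= n.+1)%N -> c (node n j) <= c (node n i).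
Proof.
move=> ij jn; apply: c_noninc; last 2 first.
- exact: node_le.
- by rewrite -(nodeN n) node_le.
by rewrite -(node0 n) node_le.
Qed.

Lemma sum_double_steps n :
  \sum_(0 <= j < n.+1) (c (node n j.-1) - c (node n j.+1)) <= 2 * (c p - c q).
Proof.
have -> : \sum_(0 <= j < n.+1) (c (node n j.-1) - c (node n j.+1)) =
    \sum_(0 <= j < n.+1) (c (node n j.-1) - c (node n j)) +
    \sum_(0 <= j < n.+1) (c (node n j) - c (node n j.+1)).
  by rewrite -big_split; apply: eq_bigr => j _ /=; ring.
have tel m : \sum_(0 <= j < m) (c (node n j) - c (node n j.+1)) =
    c (node n 0) - c (node n m).
  elim: m => [|m IH]; first by rewrite big_geq// subrr.
  by rewrite big_nat_recr//= IH; ring.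
rewrite tel nodeN node0 big_nat_recl//= subrr add0r tel node0.
have : c q <= c (node n n) by rewrite -(nodeN n) c_node_le.
lra.
Qed.

Lemma measurable_steep_cells n : measurable (steep_cells n).
Proof.
by apply: bigsetU_measurable => j _; exact: measurable_cell.
Qed.

(** Markov's inequality: the drops over the steep cells exceed [M * h n] and
their sum is at most twice the total drop. *)
Lemma steep_cells_measure n :
  (leb (steep_cells n) <= ((q - p) / n.+1%:R + 2 * (c p - c q) / M)%:E)%E.
Proof.
apply: (le_trans (Boole_inequality leb (fun j _ => measurable_cell n j))).
apply: (@le_trans _ _ (\sum_(j < n.+1)
    ((if (j == 0 :> nat)%N then h n else 0) + (c (node n j.-1) - c (node n j.+1)) / M)%:E)%E).
  apply: lee_sum => j _; rewrite /cell /steep_cell.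
  have step0 : 0 <= (c (node n j.-1) - c (node n j.+1)) / M.
    rewrite divr_ge0 ?(ltW M0)// subr_ge0 c_node_le//.
    by rewrite (leq_trans (leq_pred _)).
  have cellE : leb [set` `[node n j, node n j.+1[%R] = (h n)%:E.
    by rewrite lebesgue_measure_itv/= lte_fin -subr_gt0 nodeS h_gt0 -EFinB nodeS.
  case: ifP => [sj|_]; last first.
    by rewrite measure0 lee_fin addr_ge0//; case: ifP => // _; exact: ltW.
  rewrite [leLHS](_ : _ = (h n)%:E); last exact: cellE.
  rewrite lee_fin; case/orP: sj => [->|]; first by rewrite lerDl.
  rewrite mulrC -ltr_pdivlMr// => /ltW hle; apply: (le_trans hle).
  by rewrite lerDr; case: ifP => // _; exact: ltW.
rewrite sumEFin lee_fin big_split/= lerD//.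
  rewrite big_ord_recl/= big1 ?addr0// => j _.
rewrite -mulr_suml ler_wpM2r ?invr_ge0 ?(ltW M0)//.
have := sum_double_steps n; rewrite big_mkord //.
Qed.

Lemma not_steep_cell_slope n x : p < x < q -> ~ steep_cells n x ->
  exists y, [/\ p <= y, y < x, x - y <= 2 * h n & c y - c x <= M * (x - y)].
Proof.
move=> /andP[px xq] nx.
have [j jn /andP[jx xj]] : exists2 j, (j < n.+1)%N & node n j <= x < node n j.+1.
  pose P j := x < node n j.
  have exP : exists j, P j by exists n.+1; rewrite /P nodeN.
  case: (ex_minnP exP) => -[|j] Pj minj.
    by move: Pj; rewrite /P node0 ltNge (ltW px).
  exists j; last by rewrite (Pj : _ < _) andbT leNgt; apply/negP => /minj; rewrite ltnn.
  by rewrite ltnS -ltnS; apply: minj; rewrite /P nodeN.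
have nsj : ~~ steep_cell n j.
  apply: contra_notN nx => sj; rewrite /steep_cells -bigcup_mkord.
  by exists j => //=; rewrite /cell sj /= in_itv/= jx xj.
move: nsj; rewrite /steep_cell negb_or -leNgt -lt0n => /andP[j0 cj].
have jp : (j.-1.+1 = j)%N by rewrite prednK.
have h1 := nodeS n j; have := nodeS n j.-1; rewrite jp => h2.
have hn := h_gt0 n.
exists (node n j.-1); split.
- by rewrite -(node0 n) node_le.
- by lra.
- by lra.
have : c (node n j.+1) <= c x.
  apply: c_noninc; [exact: ltW|exact: ltW|].
  by rewrite -(nodeN n) node_le.
have : M * h n <= M * (x - node n j.-1) by rewrite ler_wpM2l ?(ltW M0)//; lra.
lra.
Qed.

End cells.

Lemma le_vanishing (x : \bar R) (a b : R) k :
  (forall n, (k <= n)%N -> (x <= (a / n.+1%:R + b)%:E)%E) -> (x <= b%:E)%E.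
Proof.
move=> xle; apply/lee_addgt0Pr => e e0.
have [n an] : exists n, `|a| / e < n.+1%:R.
  exists (Num.bound (`|a| / e)); have x0 : 0 <= `|a| / e by rewrite divr_ge0// ltW.
  by rewrite (lt_le_trans (archi_boundP x0))// ler_nat.
apply: (le_trans (xle (maxn k n) (leq_maxl _ _))).
rewrite -EFinD lee_fin addrC lerD2l ler_pdivrMr ?ltr0n//.
apply: (le_trans (ler_norm _)); rewrite mulrC -ler_pdivrMr//.
by rewrite (le_trans (ltW an))// ler_nat ltnS leq_maxr.
Qed.

(** For each [M], such a point lies in the steep cells of all sufficiently fine
subdivisions; the measure of this lower limit is at most a multiple of [M^-1]. *)
Lemma steep_points_negligible (p q : R) (c : R -> R) : p < q ->
  (forall x y, p <= x -> x <= y -> y <= q -> c y <= c x) ->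
  leb.-negligible [set x | p < x < q /\ forall M, exists2 e, 0 < e &
    forall y, p <= y -> y < x -> x - y < e -> M * (x - y) < c y - c x].
Proof.
move=> pq cni; pose C := 2 * (c p - c q).
pose T m k : set R := \bigcap_n steep_cells p q c m.+1%:R (k + n).
pose W m := \bigcup_k T m k.
have mT m k : measurable (T m k).
  by apply: bigcapT_measurable => n; exact: measurable_steep_cells.
have mW m : measurable (W m) by exact: bigcupT_measurable.
have T_le m k : (leb (T m k) <= (C / m.+1%:R)%:E)%E.
  apply: (@le_vanishing _ (q - p) _ k) => n kn.
  have m0 : 0 < m.+1%:R :> R by rewrite ltr0n.
  apply: le_trans (steep_cells_measure pq cni m0 n).
  apply: le_measure; [by apply/mem_set; exact: mT|apply/mem_set; exact: (measurable_steep_cells p q c m.+1%:R n)|].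
  by move=> x /(_ (n - k)%N I); rewrite subnKC.
have W_le m : (leb (W m) <= (C / m.+1%:R)%:E)%E.
  have ndT : {homo T m : k l / (k <= l)%N >-> (k <= l)%O}.
    move=> k l kl; apply/subsetPset => x Tx n _.
    by have := Tx (l - k + n)%N I; rewrite addnA subnKC.
  apply: (cvge_to_le (nondecreasing_cvg_mu (mu := leb) (mT m) (mW m) ndT)).
  by apply: nearW => k; exact: T_le.
have N0 : leb (\bigcap_m W m) = 0.
  apply/eqP; rewrite eq_le measure_ge0 andbT.
  apply: (@le_vanishing _ C 0 0) => m _; rewrite addr0.
  apply: le_trans (W_le m); apply: le_measure; [apply/mem_set|by apply/mem_set; exact: mW|].
    exact: bigcapT_measurable.
  by move=> x; apply.
have mN : measurable (\bigcap_m W m) by exact: bigcapT_measurable.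
exists (\bigcap_m W m); split=> // x [pxq steepx] m _.
have [e e0 He] := steepx m.+1%:R.
have [k ke] : exists k, 2 * (q - p) / e < k.+1%:R.
  exists (Num.bound (2 * (q - p) / e)).
  have x0 : 0 <= 2 * (q - p) / e.
    by rewrite divr_ge0 ?(ltW e0)// mulr_ge0// subr_ge0 ltW.
  by rewrite (lt_le_trans (archi_boundP x0))// ler_nat.
exists k => // n _; apply: contrapT => nsteep.
have m0 : 0 < m.+1%:R :> R by rewrite ltr0n.
have [y [py yx xy cyx]] := not_steep_cell_slope pq cni m0 pxq nsteep.
have : x - y < e.
  apply: (le_lt_trans xy); rewrite mulrA ltr_pdivrMr ?ltr0n//.
  rewrite [ltRHS]mulrC -ltr_pdivrMr// (lt_le_trans ke)// ler_nat ltnS leq_addr//.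
by move=> /(He y py yx); rewrite ltNge cyx.
Qed.

Definition bounded_left_slope (J : set R) (c : R -> R) (x : R) :=
  exists M, forall e, 0 < e ->
    exists y, [/\ J y, y < x, x - y < e & c y - c x <= M * (x - y)].

Lemma singleton_negligible (A : set R) :
  (forall x y, A x -> A y -> x = y) -> leb.-negligible A.
Proof.
move=> A1; have [->|/set0P[a Aa]] := eqVneq A set0; first exact: negligible_set0.
exists [set a]; split; [exact: measurable_set1|exact: lebesgue_measure_set1|].
by move=> x Ax; exact: A1.
Qed.

(** Up to its endpoints, an interval is a countable union of intervals with
rational endpoints, to which [steep_points_negligible] applies. *)
Lemma monotone_ae_bounded_left_slope (J : set R) (c : R -> R) :
  is_interval J -> (forall x y, J x -> J y -> x <= y -> c y <= c x) ->
  {ae leb, forall x, J x -> bounded_left_slope J c x}.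
Proof.
move=> Jitv cni.
pose low := [set x | J x /\ forall y, J y -> x <= y].
pose high := [set x | J x /\ forall y, J y -> y <= x].
pose bad (r : rat * rat) : set R := if `[< J (ratr r.1) /\ J (ratr r.2) /\
    (ratr r.1 < ratr r.2 :> R) >] then
  [set x | (ratr r.1 < x < ratr r.2) /\ forall M, exists2 e, 0 < e &
    forall y, ratr r.1 <= y -> y < x -> x - y < e -> M * (x - y) < c y - c x]
  else set0.
have badN r : leb.-negligible (bad r).
  rewrite /bad; case: asboolP => [[J1 [J2 r12]]|_]; last exact: negligible_set0.
  apply: steep_points_negligible => // x y px xy yq.
  apply: cni => //; apply: (Jitv _ _ J1 J2); first by rewrite px (le_trans xy).
  by rewrite yq (le_trans px xy).
pose badn n := if unpickle n is Some r then bad r else set0.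
have badnN : leb.-negligible (\bigcup_n badn n).
  apply: negligible_bigcup => n; rewrite /badn.
  by case: (unpickle n) => [r|]; [exact: badN|exact: negligible_set0].
have lowN : leb.-negligible low.
  apply: singleton_negligible => x y [Jx xl] [Jy yl].
  by apply/le_anti; rewrite xl// yl.
have highN : leb.-negligible high.
  apply: singleton_negligible => x y [Jx xl] [Jy yl].
  by apply/le_anti; rewrite xl// yl.
apply: negligibleS (negligibleU (negligibleU lowN highN) badnN).
move=> x /= /not_implyP[Jx nslope].
have [lx|nlx] := pselect (low x); first by left; left.
have [hx|nhx] := pselect (high x); first by left; right.
right.
have [a Ja ax] : exists2 a, J a & a < x.
  apply: contrapT => H; apply: nlx; split=> // y Jy; rewrite leNgt.
  by apply/negP => yx; apply: H; exists y.
have [b Jb bx] : exists2 b, J b & x < b.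
  apply: contrapT => H; apply: nhx; split=> // y Jy; rewrite leNgt.
  by apply/negP => yx; apply: H; exists y.
have [r1] := rat_in_itvoo ax; rewrite in_itv/= => /andP[ar1 r1x].
have [r2] := rat_in_itvoo bx; rewrite in_itv/= => /andP[xr2 r2b].
have J1 : J (ratr r1) by apply: (Jitv _ _ Ja Jx); rewrite !ltW.
have J2 : J (ratr r2) by apply: (Jitv _ _ Jx Jb); rewrite !ltW.
suff : bad (r1, r2) x.
  have <- : badn (pickle (r1, r2)) = bad (r1, r2) by rewrite /badn pickleK.
  by move: (pickle _) => n bx'; exists n.
rewrite /bad asboolT; last by split=> //; split=> //; exact: lt_trans xr2.
split; first by rewrite r1x xr2.
move=> M; apply: contrapT => nM; apply: nslope; exists M => e e0.
apply: contrapT => nE; apply: nM; exists e => // y r1y yx xye.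
rewrite ltNge; apply/negP => cM; apply: nE; exists y; split=> //.
by apply: (Jitv _ _ J1 Jx); rewrite r1y ltW.
Qed.

End monotone_slopes.

(** * Minimax values and critical points *)

Section minimax_values.
Context (R : realType) (E : normedModType R).
Implicit Types (phi psi : E -> R) (A : set E) (F : set (set E)).

Lemma emax_le phi A (m : R) :
  (forall u, A u -> phi u <= m) -> (emax phi A <= m%:E)%E.
Proof. by move=> Am; apply: ge_ereal_sup => _ [u Au <-]; rewrite lee_fin Am. Qed.

Lemma emax_ge phi A u : A u -> ((phi u)%:E <= emax phi A)%E.
Proof. by move=> Au; apply: ereal_sup_ubound; exists u. Qed.

Lemma minimax_le F phi A : F A -> (minimax F phi <= emax phi A)%E.
Proof. by move=> FA; apply: ereal_inf_lbound; exists A. Qed.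

Lemma minimax_mono F phi psi : (forall u, phi u <= psi u) ->
  (minimax F phi <= minimax F psi)%E.
Proof.
move=> le; apply: le_ereal_inf_tmp => _ [A FA <-]; apply: (le_trans (minimax_le phi FA)).
by apply: ge_ereal_sup => _ [u Au <-]; apply: le_trans (emax_ge psi Au); rewrite lee_fin.
Qed.

Lemma minimax_ltW F phi (m : R) : (minimax F phi < m%:E)%E ->
  exists2 A, F A & forall u, A u -> phi u <= m.
Proof.
move=> /ereal_inf_lt[_ [A FA <-] Am]; exists A => // u Au.
by rewrite -lee_fin (le_trans (emax_ge phi Au))// ltW.
Qed.

(** Members of the family are compact, so [phi] is bounded on them; the gap
with the boundary value excludes [-oo]. *)
Lemma minimax_fin S d bd F phi : continuous phi -> homotopic_family S d bd F ->
  F !=set0 -> (emax phi bd < minimax F phi)%E -> minimax F phi \is a fin_num.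
Proof.
move=> phic [D [D0 [eta0 [cD _ _ _ FE]]]] [A FA] gap.
rewrite fin_numE; apply/andP; split.
  by apply: contraTN gap => /eqP ->; rewrite ltNge leNye.
have [f [fc _ _ Af]] : exists f : 'rV[R]_d -> E, [/\ {within D, continuous f},
    f @` D `<=` S, (forall x, D0 x -> f x = eta0 x) & A = f @` D].
  by move: FA; rewrite FE.
have : bounded_set ((phi \o f) @` D).
  apply: compact_bounded; apply: continuous_compact => //.
  by move=> x; apply: (continuous_comp (fc x)); exact: phic.
move=> [M [_ MD]].
have : (minimax F phi <= (M + 1)%:E)%E.
  apply: (le_trans (minimax_le phi FA)); apply: emax_le => u; rewrite Af => -[x Dx <-].
  rewrite (le_trans (ler_norm _))//; apply: (MD (M + 1)); first by rewrite ltrDl.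
  by exists x.
by case: (minimax F phi).
Qed.

Lemma emax_gap phi A (c : R) : (emax phi A < c%:E)%E ->
  exists2 g, 0 < g & forall u, A u -> phi u <= c - g.
Proof.
case E1 : (emax phi A) => [m| |]//= Ac.
  exists (c - m); first by rewrite subr_gt0 -lte_fin.
  by move=> u Au; rewrite opprB addrC subrK -lee_fin -E1 emax_ge.
exists 1 => // u Au; have := emax_ge phi Au.
by rewrite E1 leeNy_eq.
Qed.

End minimax_values.

Section sphere_points.
Context (R : realType) (E H : completeNormedModType R).
Context (ipE : {dot E for (@idfun R)}) (ipH : {dot H for (@idfun R)}).
Hypothesis (hilbE : hilbert ipE) (hilbH : hilbert ipH).
Context (iota : {linear E -> H}).
Hypothesis triple : gelfand_triple iota ipH.
Variables (mu : R) (phi : E -> R).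
Hypothesis mu_gt0 : 0 < mu.

Local Notation b := (fun u v : E => ipH (iota u) (iota v)).

Lemma pullback_contractive : contractive_form b.
Proof.
have [_ iota1 _] := triple.
split=> [a u v w|u v|u|u v].
- by rewrite linearP ipDl ipZl.
- exact: ipC.
- by rewrite hilbH sqr_ge0.
- by rewrite (le_trans (ip_cauchy hilbH _ _))// ler_pM.
Qed.

(** A tangent vector where the differential exceeds [delta] in absolute value
is a steep direction up to its sign. *)
Lemma not_steep_dual_norm delta u : ~ steep b phi delta u -> 0 <= delta ->
  0 <= dual_norm_on_sphere iota ipH phi u <= delta.
Proof.
move=> nst delta0.
have T0 : tangent iota ipH u 0.
  by have := formZr pullback_contractive 0 0 u; rewrite /tangent/= scale0r mul0r.
apply/andP; split.
  apply: (@le_trans _ _ `|frechet phi u 0|) => //.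
  apply: sup_upper_bound; last by exists 0 => //; split=> //; rewrite normr0.
  split; first by exists `|frechet phi u 0|, 0 => //; split=> //; rewrite normr0.
  by exists (opnorm (frechet phi u)) => _ [v [_ v1] <-]; exact: opnorm_ge.
apply: ge_sup.
  by exists `|frechet phi u 0|, 0 => //; split=> //; rewrite normr0.
move=> _ [v [Tv v1] <-]; rewrite leNgt; apply/negP => dv; apply: nst.
have [v0|v0] := leP 0 (frechet phi u v).
  exists (- v); split.
  - by rewrite -scaleN1r (formZr pullback_contractive) [X in _ * X]Tv mulr0.
  - by rewrite normrN.
  - by rewrite -scaleN1r clinZ mulN1r ltrN2; move: dv; rewrite ger0_norm.
exists v; split=> //.
by move: dv; rewrite ltr0_norm// ltrNr.
Qed.

(** [d + 1] independent vectors in a negative subspace can be made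
orthonormal. *)
Lemma not_saddle_morse_index d delta u : sphere iota ipH mu u ->
  ~ saddle b mu ipE phi d delta u ->
  (approx_morse_index iota ipH phi delta u <= d%:R%:E)%E.
Proof.
move=> uS nsad; apply: ge_ereal_sup => _ [L [[LT Lsub] Lneg] <-].
apply: ge_ereal_sup => _ [n [v [vfree Lv]] <-].
rewrite lee_fin ler_nat leqNgt; apply/negP => dn; apply: nsad.
have [e [Le eE]] := orthonormal_in_subspace hilbE Lsub vfree Lv dn.
exists e; split=> [i|//|c]; first exact: (LT _ (Le i)).
cbv zeta; set w := \sum_i _.
have Lw : L w by exact: submod_closed_sum.
have [->|w0] := eqVneq w 0.
  rewrite normr0 expr0n/= mulr0 -(scale0r 0) (sphere_hessZ pullback_contractive).
  by rewrite expr0n/= mul0r.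
have := Lneg w Lw w0; rewrite /D2 /sphere_hess.
by have -> : ipH (iota u) (iota u) = mu by []; move/ltW.
Qed.

End sphere_points.

Section minimax_critical_point.
Context (R : realType) (E H : completeNormedModType R).
Context (ipE : {dot E for (@idfun R)}) (ipH : {dot H for (@idfun R)}).
Hypothesis (hilbE : hilbert ipE) (hilbH : hilbert ipH).
Context (iota : {linear E -> H}).
Hypothesis triple : gelfand_triple iota ipH.
Variable mu : R.
Hypothesis mu_gt0 : 0 < mu.
Variables (d : nat) (bd : set E) (F : set (set E)).
Hypothesis F_homotopic : homotopic_family (sphere iota ipH mu) d bd F.

Local Notation b := (fun u v : E => ipH (iota u) (iota v)).

(** If no point on the given set [A] were suitable, [deform_below] would yield
another member of the family, with the same boundary values because the boundary
stays below level [c - eps], lying strictly below the minimax level. *)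
Lemma minimax_critical_point (phi : E -> R) (alpha c K delta : R) :
  0 < alpha -> C2 phi -> holder_on_bounded_sets alpha phi ->
  minimax F phi = c%:E -> (emax phi bd < c%:E)%E -> 0 <= K -> 0 < delta ->
  (forall eps0, 0 < eps0 -> exists eps A, [/\ 0 < eps <= eps0, F A,
     forall u, A u -> phi u <= c + eps &
     forall u, A u -> c - eps <= phi u -> `|u| <= K]) ->
  exists u, [/\ sphere iota ipH mu u, `|phi u - c| <= delta, `|u| <= K,
    0 <= dual_norm_on_sphere iota ipH phi u <= delta &
    (approx_morse_index iota ipH phi delta u <= d%:R%:E)%E].
Proof.
move=> alpha0 phiC2 phiH mmc gap K0 delta0 tight.
have bform := pullback_contractive hilbH triple.
have [g g0 bdg] := emax_gap gap.
have [eps1 eps10 deform] := deform_below bform mu_gt0 hilbE alpha0 phiC2 phiH d K0 delta0.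
have [D [D0 [eta0 [cD D0D _ [_ eta0E] FE]]]] := F_homotopic.
have min0 : 0 < Num.min (Num.min eps1 g) delta by rewrite !lt_min eps10 g0 delta0.
have [eps [A [/andP[eps0]]]] := tight _ min0.
rewrite !le_min => /andP[/andP[epse epsg] epsd] FA Atop Alow.
have [f [fc fS f0 Af]] : exists f : 'rV[R]_d -> E, [/\ {within D, continuous f},
    f @` D `<=` sphere iota ipH mu, (forall x, D0 x -> f x = eta0 x) & A = f @` D].
  by move: FA; rewrite FE.
have AfD x : D x -> A (f x) by move=> Dx; rewrite Af; exists x.
apply: contrapT => none.
have [|||x Dx low|f' [f'c f'S f'f f'low]] := deform D f c eps cD fc.
- by move=> x Dx; apply: fS; exists x.
- by rewrite eps0 epse.
- by move=> x Dx; exact/Atop/AfD.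
- have fK := Alow _ (AfD x Dx) low; split=> //.
  apply: contrapT => nss; apply: none; exists (f x).
  have fxS : sphere iota ipH mu (f x) by apply: fS; exists x.
  split=> //.
  + rewrite ler_distl; apply/andP; split; first by rewrite (le_trans _ low)// lerB.
    by rewrite (le_trans (Atop _ (AfD x Dx)))// lerD2l.
  + apply: not_steep_dual_norm => //; last exact: ltW.
    by move=> st; apply: nss; left.
  + apply: (not_saddle_morse_index hilbE hilbH triple fxS) => sd.
    by apply: nss; right.
have FA' : F (f' @` D).
  rewrite FE; exists f'; split=> //.
  - by move=> _ [x Dx <-]; exact: f'S.
  - move=> x D0x; rewrite f'f; [exact: f0|exact: D0D|].
    rewrite f0//; apply: (@le_trans _ _ (c - g)); last by rewrite lerB.
    by apply: bdg; rewrite -eta0E; exists x.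
have := minimax_le phi FA'; rewrite mmc leNgt => /negP; apply.
apply: (@le_lt_trans _ _ (c - eps / 4)%:E).
  by apply: emax_le => _ [x Dx <-]; exact: f'low.
by rewrite lte_fin ltrBlDr ltrDl divr_gt0.
Qed.

End minimax_critical_point.

Lemma coercive_sublevel_bounded (R : realType) (E : normedModType R)
    (A B : E -> R) (a m : R) : coercive A \/ coercive B ->
  exists2 K, 0 <= K & forall u, A u <= a -> B u <= m -> `|u| <= K.
Proof.
case=> [/(_ (a + 1))|/(_ (m + 1))] [r hr]; exists `|r| => // u Aa Bm;
  rewrite leNgt; apply/negP => ru;
  have := hr u (le_trans (ler_norm r) (ltW ru)); lra.
Qed.

(** Take [G] optimal for [Phi r] up to [rho - r].  Where [Phi rho] is within
[eps = (`|M| + 1) * (rho - r)] of [c rho], the identity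
[(rho - r) * B = Phi r - Phi rho] bounds [B] by [2 * (`|M| + 1)], and
[A = Phi rho + rho * B] is bounded in turn. *)
Lemma monotonicity_trick (R : realType) (E : normedModType R) (F : set (set E))
    (A B : E -> R) (I : set R) (c : R -> R) (Phi : R -> E -> R) (rho : R) :
  coercive A \/ coercive B -> (forall u, 0 <= B u) ->
  (forall r, I r -> forall u, Phi r u = A u - r * B u) ->
  (forall r, I r -> minimax F (Phi r) = (c r)%:E) ->
  I rho -> 0 < rho -> bounded_left_slope I c rho ->
  exists2 K, 0 <= K & forall eps0, 0 < eps0 -> exists eps G, [/\ 0 < eps <= eps0, F G,
     forall u, G u -> Phi rho u <= c rho + eps &
     forall u, G u -> c rho - eps <= Phi rho u -> `|u| <= K].
Proof.
move=> coer B0 PhiE mmc Irho rho0 [M slope].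
pose M1 := `|M| + 1; have M1_gt0 : 0 < M1 by rewrite ltr_wpDl.
have [K K0 bK] := coercive_sublevel_bounded (c rho + M1 + rho * (2 * M1)) (2 * M1) coer.
exists K => // eps0 eps00.
have e00 : 0 < Num.min 1 (eps0 / M1) by rewrite lt_min ltr01 divr_gt0.
have [r [Ir rrho]] := slope _ e00.
set e := rho - r; rewrite lt_min => /andP[e1 eeps] cr.
have e0 : 0 < e by rewrite subr_gt0.
have [G FG Gr] : exists2 G, F G & forall u, G u -> Phi r u <= c r + e.
  by apply: minimax_ltW; rewrite mmc// lte_fin ltrDl.
have crM : c r + e <= c rho + M1 * e.
  have : M * e <= `|M| * e by rewrite ler_wpM2r ?ler_norm// ltW.
  by rewrite /M1 mulrDl mul1r; lra.
have PhiB u : Phi r u = Phi rho u + e * B u.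
  by rewrite !PhiE// /e; ring.
have top u : G u -> Phi rho u <= c rho + M1 * e.
  move=> Gu; apply: le_trans crM; apply: le_trans (Gr u Gu).
  by rewrite PhiB lerDl mulr_ge0// ltW.
have M1e : M1 * e <= M1 by rewrite ler_piMr// ltW.
exists (M1 * e), G; split=> //.
  by rewrite mulr_gt0//= mulrC -ler_pdivlMr// ltW.
move=> u Gu low.
have Bu : B u <= 2 * M1.
  rewrite -(ler_pM2l e0); have := Gr u Gu; rewrite PhiB.
  by rewrite (mulrC e (2 * M1)) -mulrA; lra.
apply: bK => //.
have -> : A u = Phi rho u + rho * B u by rewrite PhiE//; ring.
rewrite lerD//; first by rewrite (le_trans (top u Gu))// lerD2l.
by rewrite ler_wpM2l// ltW.
Qed.

Theorem theorem1p10 (R : realType) (E H : completeNormedModType R)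
    (ipE : {dot E for (@idfun R)}) (ipH : {dot H for (@idfun R)})
    (hilbE : hilbert ipE) (hilbH : hilbert ipH)
    (infE : inf_dim E) (infH : inf_dim H)
    (iota : {linear E -> H}) (triple : gelfand_triple iota ipH)
    (mu : R) (mu_gt0 : 0 < mu)
    (I : set R) (I_itv : is_interval I) (I_gt0 : forall rho, I rho -> 0 < rho)
    (A B : E -> R) (Phi : R -> E -> R)
    (PhiE : forall rho, I rho -> forall u, Phi rho u = A u - rho * B u)
    (Phi_C2 : forall rho, I rho -> C2 (Phi rho))
    (B_ge0 : forall u, 0 <= B u)
    (AB_coercive : coercive A \/ coercive B)
    (alpha : R) (alpha_gt0 : 0 < alpha) (alpha_le1 : alpha <= 1)
    (Phi_holder : forall rho, I rho -> holder_on_bounded_sets alpha (Phi rho))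
    (d : nat) (bd : set E) (bd_sphere : bd `<=` sphere iota ipH mu)
    (F : set (set E)) (F_homotopic : homotopic_family (sphere iota ipH mu) d bd F)
    (F_neq0 : F !=set0)
    (minimax_gt : forall rho, I rho ->
      (emax (Phi rho) bd < minimax F (Phi rho))%E) :
  {ae (@lebesgue_measure R), forall rho, I rho ->
    exists (u : nat -> E) (zeta : nat -> R),
      (forall n, sphere iota ipH mu (u n)) /\
      (forall n, 0 < zeta n) /\ zeta n @[n --> \oo] --> 0 /\
      [/\ (Phi rho (u n))%:E @[n --> \oo] --> minimax F (Phi rho),
          dual_norm_on_sphere iota ipH (Phi rho) (u n) @[n --> \oo] --> 0,
          bounded_set (range u) &
          forall n,
            (approx_morse_index iota ipH (Phi rho) (zeta n) (u n) <= d%:R%:E)%E]}.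
Proof.
pose c rho := fine (minimax F (Phi rho)).
have mmc rho : I rho -> minimax F (Phi rho) = (c rho)%:E.
  move=> Irho; rewrite fineK//; apply: (minimax_fin _ F_homotopic F_neq0 (minimax_gt _ Irho)).
  by move=> u; apply: differentiable_continuous; exact: (Phi_C2 _ Irho).1.1.
have c_noninc x y : I x -> I y -> x <= y -> c y <= c x.
  move=> Ix Iy xy; rewrite -lee_fin -!mmc//; apply: minimax_mono => u.
  by rewrite !PhiE// lerD2l lerN2 ler_wpM2r.
have [N [mN N0 slopeN]] := monotone_ae_bounded_left_slope I_itv c_noninc.
exists N; split=> // rho bad; apply: slopeN => slope; apply: bad => Irho.
have [K K0 tight] := monotonicity_trick AB_coercive B_ge0 PhiE mmc Irho (I_gt0 _ Irho)
  (slope Irho).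
pose zeta n : R := n.+1%:R^-1.
have zeta_gt0 n : 0 < zeta n by rewrite invr_gt0 ltr0n.
have zeta0 : zeta n @[n --> \oo] --> 0 by exact: cvg_harmonic.
have [n|u uP] := @choice _ _ (fun n u => [/\ sphere iota ipH mu u,
    `|Phi rho u - c rho| <= zeta n, `|u| <= K,
    0 <= dual_norm_on_sphere iota ipH (Phi rho) u <= zeta n &
    (approx_morse_index iota ipH (Phi rho) (zeta n) u <= d%:R%:E)%E]).
  apply: (minimax_critical_point hilbE hilbH triple mu_gt0 F_homotopic alpha_gt0
    (Phi_C2 _ Irho) (Phi_holder _ Irho) (mmc rho Irho)) => //.
  by rewrite -mmc//; exact: minimax_gt.
exists u, zeta; split; first by move=> n; case: (uP n).
split=> //; split=> //; split.
- rewrite mmc//.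
  suff cv : Phi rho (u n) @[n --> \oo] --> c rho by apply: cvg_EFin => //; exact: nearW.
  apply/cvgrPdist_le => e e0; move/cvgrPdist_le : zeta0 => /(_ e e0).
  apply: filterS => n; rewrite sub0r normrN (ger0_norm (ltW (zeta_gt0 n))) => ze.
  by have [_ h _ _ _] := uP n; rewrite distrC (le_trans h).
- apply: (squeeze_cvgr (f := cst 0) (h := zeta)) => //; last exact: cvg_cst.
  by apply: nearW => n; have [_ _ _ h _] := uP n.
- exists K; split; first exact: num_real.
  by move=> x Kx _ [n _ <-]; have [_ _ h _ _] := uP n; exact: le_trans h (ltW Kx).
- by move=> n; have [] := uP n.
Qed.
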